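(* Fix $\eta > 0$ and positive integers $m, n, v$ such that $v \geq 3$ and $m \leq n(v-1)$. Let $\{f_q\}$ be a countable family of $C^2$ functions $f_q : (\mathbb{R}^n)^v \to \mathbb{R}^m$ with the following property: for every $q$, the derivative $Df_q$ has full rank at every point of the zero set of $f_q$ in $[0,\eta]^{nv}$. Then there exists a set $E \subseteq [0,\eta]^n$ of Hausdorff dimension at least $\frac{m}{v-1}$ and Minkowski dimension $n$ such that $f_q(x_1, \ldots, x_v) \neq 0$ for every $v$-tuple of distinct points $x_1, \ldots, x_v \in E$ and every function $f_q$ of the family.
   Context: Here $(\mathbb{R}^n)^v$ is identified with $\mathbb{R}^{nv}$, and $Df_q$ is the $m \times nv$ Jacobian matrix of $f_q$; full rank means rank $m$. ''Distinct points'' means pairwise distinct points of $\mathbb{R}^n$. *)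

(* Defs.v *)
From HB Require Import structures.
From mathcomp Require Import all_boot all_order all_algebra.
From mathcomp Require Import all_classical all_reals all_analysis.

Set Implicit Arguments.
Unset Strict Implicit.
Unset Printing Implicit Defensive.

Import Order.TTheory GRing.Theory Num.Theory.
Import numFieldNormedType.Exports.

Local Open Scope classical_set_scope.
Local Open Scope ring_scope.

Definition cube (R : realType) (eta : R) (d : nat) : set 'rV[R]_d :=
  [set x | forall j, 0 <= x 0 j <= eta].

(* The identification of (R^n)^v with R^(nv): x_1, ..., x_v are concatenated. *)
Definition tuple_point (R : realType) (n v : nat) (x : 'I_v -> 'rV[R]_n) :
    'rV[R]_(v * n) :=
  mxvec (\matrix_(i < v) x i).

(* C^(k+1) means Frechet differentiable everywhere with C^k derivative, the
   derivative being the matrix-valued map 'J f, flattened by mxvec. *)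
Fixpoint class_C (R : realType) (k d m : nat) (f : 'rV[R]_d -> 'rV[R]_m)
    {struct k} : Prop :=
  match k with
  | 0 => continuous f
  | k'.+1 => (forall x, differentiable f x) /\
             class_C k' (fun x => mxvec ('J f x))
  end.

(* The library norm on 'rV[R]_n is the sup norm, hence this distance. *)
Definition euclidean_dist (R : realType) (n : nat) (x y : 'rV[R]_n) : R :=
  Num.sqrt (\sum_j (x 0 j - y 0 j) ^+ 2).

(* Equal to -oo on the empty set. *)
Definition diam (R : realType) (n : nat) (U : set 'rV[R]_n) : \bar R :=
  ereal_sup [set (euclidean_dist p.1 p.2)%:E | p in U `*` U].

(* diam(U)^s, with the conventions diam(U)^0 = 1 if U is nonempty and
   diam(set0)^s = 0 for every s. *)
Definition diam_pow (R : realType) (n : nat) (s : R) (U : set 'rV[R]_n) :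
    \bar R :=
  if `[< U = set0 >] then 0%E else poweR (diam U) s.

Definition hausdorff_premeasure (R : realType) (n : nat) (s delta : R)
    (A : set 'rV[R]_n) : \bar R :=
  ereal_inf [set (\sum_(0 <= i <oo) diam_pow s (U i))%E |
    U in [set U : nat -> set 'rV[R]_n |
      (forall i, (diam (U i) <= delta%:E)%E) /\ A `<=` \bigcup_i U i]].

(* The premeasure is nonincreasing in delta, so this supremum is its limit as
   delta tends to 0. *)
Definition hausdorff_measure (R : realType) (n : nat) (s : R)
    (A : set 'rV[R]_n) : \bar R :=
  ereal_sup [set hausdorff_premeasure s delta A |
    delta in [set delta : R | 0 < delta]].

Definition hausdorff_dim (R : realType) (n : nat) (A : set 'rV[R]_n) : \bar R :=
  ereal_inf [set s%:E |
    s in [set s : R | 0 <= s /\ hausdorff_measure s A = 0%E]].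

(* The least number of sets of diameter at most delta that cover A
   (+oo if no finite family does). *)
Definition covering_number (R : realType) (n : nat) (A : set 'rV[R]_n)
    (delta : R) : \bar R :=
  ereal_inf [set (k%:R)%:E |
    k in [set k : nat | exists U : 'I_k -> set 'rV[R]_n,
      (forall i, (diam (U i) <= delta%:E)%E) /\ A `<=` \bigcup_i U i]].

(* A has Minkowski dimension d: the limit of log N(A, delta) / log (1/delta)
   as delta tends to 0 from the right exists and equals d, i.e. the lower and
   upper Minkowski dimensions of A are both d. *)
Definition has_minkowski_dim (R : realType) (n : nat) (A : set 'rV[R]_n)
    (d : R) : Prop :=
  (lne (covering_number A delta) * ((ln delta^-1)^-1)%:E)%E
    @[delta --> 0^'+] --> d%:E.

(* Main.v *)
(* The zero sets of the [f q] in the cube form a countable union of [thin]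
   pieces: near a zero, strict differentiability makes the zero set a Lipschitz
   graph over [v * n - m] coordinates, so at most
   [C * G ^ (v * n - m)] cubes of the grid of mesh [eta / G] meet it.

   Passing from the grid of index [N] to that of index [N * A * B], choose
   independently at random one small cube in each cube of the grid [N * A].
   The expected number of [v]-tuples of chosen cubes that meet the first [k]
   pieces is at most [C * (N A B) ^ (v n - m) * B ^ (- v n)], and once
   [B ^ m >> A ^ (n (v - 1) - m)] it suffices to discard half of the cubes of
   the grid [N * A].  Then [(N A B) ^ (m / (v - 1))] is comparable to [A ^ n],
   which is what Frostman's mass distribution principle needs for the
   dimension [m / (v - 1)].

   At every stage one starts again from the whole grid, and the set [E]
   consists of the points that belong to chosen cubes at all but finitely many
   stages.  It is not closed but dense in the cube, so its Minkowski dimension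
   is [n], and it still contains the Cantor set of branches starting from any
   cube of any stage. *)
Require Import Defs.
From HB Require Import structures.
From mathcomp Require Import all_boot all_order all_algebra.
From mathcomp Require Import all_classical all_reals all_analysis.
From mathcomp Require Import zify ring lra.

Set Implicit Arguments.
Unset Strict Implicit.
Unset Printing Implicit Defensive.

Import Order.TTheory GRing.Theory Num.Theory.
Import numFieldNormedType.Exports.

Local Open Scope classical_set_scope.
Local Open Scope ring_scope.

(** * Averaging: the choice of one subcube in each cube *)

(** The [v] conditions concern different arguments, so a uniformly random [s] satisfies them all
    with probability at most [#|P| ^ - v]; multiplying out avoids division. *)
Lemma card_ffun_prescribed (I P : finType) (v : nat) (T : 'I_v -> I)
    (p : 'I_v -> P) : injective T ->
  (#|[set s : {ffun I -> P} | [forall i, s (T i) == p i]]%SET| * #|P| ^ v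
     <= #|P| ^ #|I|)%N.
Proof.
move=> Tinj.
pose F (x : I) := [pred y : P | [forall i, (T i == x) ==> (y == p i)]].
have -> : #|[set s : {ffun I -> P} | [forall i, s (T i) == p i]]%SET|
    = #|family F|.
  apply: eq_card => s; rewrite finset.in_set; apply/forallP/familyP => h x.
    by apply/forallP => i; apply/implyP => /eqP <-; apply: h.
  by have /forallP/(_ x) := h (T x); rewrite eqxx.
rewrite card_family foldrE big_map -[in X in (_ <= X)%N]prod_nat_const.
have -> : (#|P| ^ v = \prod_(x in codom T) #|P|)%N.
  by rewrite prod_nat_const card_codom // card_ord.
have codom1 : (\prod_(x in codom T) #|F x| <= 1)%N.
  apply: (big_ind (fun k => k <= 1)%N) => // [a b a1 b1|x /codomP[i ->]].
    by rewrite -(muln1 1%N) leq_mul.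
  rewrite -(card1 (p i)); apply: subset_leq_card; apply/fintype.subsetP => y.
  by rewrite !inE => /forallP/(_ i); rewrite eqxx.
rewrite big_enum /= (bigID (mem (codom T))) /=.
rewrite [leqRHS](bigID (mem (codom T))) /= mulnAC mulnC.
rewrite [leqRHS]mulnC leq_mul //.
  by apply: leq_prod => x _; exact: max_card.
by rewrite -[leqRHS]mul1n leq_mul.
Qed.

(* Averaging over all selections [s]. *)
Lemma exists_selection (I P : finType) (v : nat)
    (B : {set {ffun 'I_v -> I} * {ffun 'I_v -> P}}) :
  (0 < #|P|)%N -> (forall b, b \in B -> injective b.1) ->
  exists s : {ffun I -> P},
    (#|[set b in B | [forall i, s (b.1 i) == b.2 i]]%SET| * #|P| ^ v <= #|B|)%N.
Proof.
move=> P0 Binj; apply/existsP; apply: contraT; rewrite negb_exists => /forallP H.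
have : (\sum_(s : {ffun I -> P}) #|B| < \sum_(s : {ffun I -> P})
    #|[set b in B | [forall i, s (b.1 i) == b.2 i]]%SET| * #|P| ^ v)%N.
  rewrite ltnNge; apply/negP => Hle.
  have /card_gt0P[p0 _] := P0.
  have : (\sum_(s : {ffun I -> P}) (#|B|).+1 <= \sum_(s : {ffun I -> P})
    #|[set b in B | [forall i, s (b.1 i) == b.2 i]]%SET| * #|P| ^ v)%N.
    by apply: leq_sum => s _; rewrite ltnNge H.
  move=> /leq_trans/(_ Hle); rewrite !sum_nat_const leq_mul2l ltnn orbF.
  by rewrite -leqn0 leqNgt card_ffun expn_gt0 P0.
rewrite sum_nat_const card_ffun -big_distrl /=.
rewrite ltnNge => /negP; case.
under eq_bigr => s _ do rewrite -sum1_card.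
(* Double counting: each [b] is realised by at most a fraction [#|P| ^ - v] of the selections. *)
rewrite (exchange_big_dep (mem B)) /=; last by move=> s b _; rewrite inE => /andP[].
rewrite big_distrl /= mulnC -sum_nat_const leq_sum // => b bB.
apply: leq_trans (card_ffun_prescribed b.2 (Binj b bB)).
rewrite leq_mul2r sum1_card.
apply/orP; right; apply: subset_leq_card; apply/fintype.subsetP => s.
rewrite inE => sb.
have : b \in [set b in B | [forall i, s (b.1 i) == b.2 i]]%SET by exact: sb.
by rewrite inE => /andP[].
Qed.

Lemma digits_lt (M B a b : nat) : (a < M -> b < B -> a * B + b < M * B)%N.
Proof. nia. Qed.

(** Index of the subcube at position [p] inside the cube [T], when each side of [T] is cut into [B]
    pieces. *)
Definition digits (n M B : nat) (T : {ffun 'I_n -> 'I_M})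
    (p : {ffun 'I_n -> 'I_B}) : {ffun 'I_n -> 'I_(M * B)} :=
  [ffun j => Ordinal (digits_lt (ltn_ord (T j)) (ltn_ord (p j)))].

Lemma digits_div (n M B : nat) (T : {ffun 'I_n -> 'I_M})
    (p : {ffun 'I_n -> 'I_B}) j : (digits T p j %/ B = T j)%N.
Proof.
by rewrite ffunE /= divnMDl ?divn_small ?addn0 // (leq_ltn_trans _ (ltn_ord (p j))).
Qed.

Lemma digits_mod (n M B : nat) (T : {ffun 'I_n -> 'I_M})
    (p : {ffun 'I_n -> 'I_B}) j : (digits T p j %% B = p j)%N.
Proof. by rewrite ffunE /= modnMDl modn_small. Qed.

Lemma digits_inj (n M B : nat) (T T' : {ffun 'I_n -> 'I_M})
    (p p' : {ffun 'I_n -> 'I_B}) : digits T p = digits T' p' -> T = T' /\ p = p'.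
Proof.
move=> e; split; apply/ffunP => j; apply/val_inj => /=.
  by rewrite -(digits_div T p) e digits_div.
by rewrite -(digits_mod T p) e digits_mod.
Qed.

(* A cube with index [a] in the grid of mesh 1/N has [A ^ n] subcubes in the
   grid of mesh 1/(N A); half of them keep one subcube of the grid of mesh
   1/(N A B) each. *)
Lemma select_subcubes (n v N A B : nat) (bad : ('I_v -> 'I_n -> nat) -> bool) :
  (0 < v)%N -> (0 < B)%N ->
  (#|[set b : {ffun 'I_v -> {ffun 'I_n -> 'I_(N * A * B)}} |
       bad (fun i j => b i j)]%SET| * 2 <= A ^ n * (B ^ n) ^ v)%N ->
  exists ch : {ffun 'I_n -> nat} -> seq {ffun 'I_n -> nat},
    [/\ forall a : {ffun 'I_n -> nat}, (forall j, a j < N)%N ->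
          uniq (ch a) /\ size (ch a) = (A ^ n)./2,
        forall a c, c \in ch a -> forall j, (c j %/ (A * B) = a j)%N,
        forall a a' c c', c \in ch a -> c' \in ch a' ->
          (forall j, c j %/ B = c' j %/ B)%N -> c = c'
      & forall c : 'I_v -> {ffun 'I_n -> nat}, injective c ->
          (forall i, exists a, c i \in ch a) -> ~~ bad (fun i j => c i j)].
Proof.
move=> v0 B0 Hbad.
pose I := {ffun 'I_n -> 'I_(N * A)}; pose P := {ffun 'I_n -> 'I_B}.
pose cube_of (b : {ffun 'I_v -> I} * {ffun 'I_v -> P}) :=
  [ffun i => digits (b.1 i) (b.2 i)].
pose Bd := [set b : {ffun 'I_v -> I} * {ffun 'I_v -> P} |
  injectiveb b.1 && bad (fun i j => cube_of b i j)]%SET.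
have cardP : #|P| = (B ^ n)%N by rewrite card_ffun !card_ord.
have P0 : (0 < #|P|)%N by rewrite cardP expn_gt0 B0.
have Binj b : b \in Bd -> injective b.1.
  by rewrite inE => /andP[/injectiveP].
have [s Hs] := exists_selection P0 Binj.
set Bs := [set b in Bd | _]%SET in Hs.
have Bd_le : (#|Bd| * 2 <= A ^ n * (B ^ n) ^ v)%N.
  apply: leq_trans Hbad; rewrite leq_mul2r /=.
  have inj : injective cube_of.
    move=> [T p] [T' p'] /ffunP e; congr pair; apply/ffunP => i;
    by move: (e i); rewrite !ffunE => /digits_inj[].
  rewrite -(card_imset _ inj); apply: subset_leq_card.
  by apply/fintype.subsetP => _ /imsetP[b + ->]; rewrite !inE => /andP[].
have Bs_le : (#|Bs| <= (A ^ n)./2)%N.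
  rewrite -[leqLHS]doubleK half_leq // -muln2.
  have Bnv : (0 < (B ^ n) ^ v)%N by rewrite !expn_gt0 B0.
  rewrite -(leq_pmul2r Bnv); apply: leq_trans Bd_le.
  by rewrite mulnAC leq_mul2r /= -cardP.
pose i0 := Ordinal v0.
(* Every bad tuple realised by [s] is destroyed by deleting the parent cube of its first member.
   This costs at most half of [A ^ n] cubes in total, hence no more than that inside any single cube
   [a]. *)
pose Del := [set (b : {ffun 'I_v -> I} * {ffun 'I_v -> P}).1 i0 | b in Bs]%SET.
have Del_le : (#|Del| <= (A ^ n)./2)%N.
  by apply: leq_trans Bs_le; exact: leq_imset_card.
pose toN (c : {ffun 'I_n -> 'I_(N * A * B)}) : {ffun 'I_n -> nat} :=
  [ffun j => c j : nat].
have toNE c j : toN c j = c j :> nat by rewrite ffunE.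
have toN_inj : injective toN.
  by move=> c c' /ffunP e; apply/ffunP => j; apply/val_inj;
     have := e j; rewrite !ffunE.
pose over (a : {ffun 'I_n -> nat}) := [set T : I | [forall j, T j %/ A == a j]%N]%SET.
(* Truncating the list gives every cube the same number of children, so that mass can be shared
   equally. *)
pose ch a := [seq toN (digits T (s T)) |
  T <- take (A ^ n)./2 (enum (over a :\: Del)%SET)].
have chP a c : c \in ch a -> exists2 T, T \in (over a :\: Del)%SET &
    c = toN (digits T (s T)).
  by move=> /mapP[T /mem_take]; rewrite mem_enum => TD ->; exists T.
exists ch; split.
- move=> a aN; split.
    rewrite map_inj_uniq ?take_uniq ?enum_uniq //.
    by move=> T T' /toN_inj/digits_inj[].
  rewrite size_map size_takel // -cardE.
  have over_ge : (A ^ n <= #|over a|)%N.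
    pose g (u : {ffun 'I_n -> 'I_A}) : I :=
      [ffun j => Ordinal (digits_lt (aN j) (ltn_ord (u j)))].
    have ginj : injective g.
      move=> u u' /ffunP e; apply/ffunP => j; apply/val_inj => /=.
      by have := congr1 val (e j); rewrite !ffunE /= => /addnI.
    have <- : #|{ffun 'I_n -> 'I_A}| = (A ^ n)%N by rewrite card_ffun !card_ord.
    rewrite -(card_imset _ ginj); apply: subset_leq_card.
    apply/fintype.subsetP => _ /imsetP[u _ ->]; rewrite inE.
    apply/forallP => j; rewrite ffunE /= divnMDl ?divn_small ?addn0 //.
    by rewrite (leq_ltn_trans _ (ltn_ord (u j))).
  rewrite cardsD.
  have : (#|over a :&: Del| <= (A ^ n)./2)%N.
    by apply: leq_trans Del_le; rewrite subset_leq_card // finset.subsetIr.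
  move: over_ge; set x := #|over a|; set y := #|_ :&: _|.
  have := odd_double_half (A ^ n); rewrite -addnn; lia.
- move=> a c /chP[T]; rewrite !inE => /andP[_ /forallP Ta] -> j.
  by rewrite toNE [(A * B)%N]mulnC divnMA digits_div (eqP (Ta j)).
- move=> a a' c c' /chP[T _ ->] /chP[T' _ ->] e; suff -> : T = T' by [].
  apply/ffunP => j; apply/val_inj => /=.
  by have := e j; rewrite !toNE !digits_div.
- move=> c cinj cch; apply/negP => cbad.
  have {cch} /fin_all_exists[T HT] : forall i, exists T, T \notin Del /\
     c i = toN (digits T (s T)).
    by move=> i; have [a /chP[T]] := cch i; rewrite inE => /andP[TD _] ->; exists T.
  (* A selected cube is determined by its parent, so distinct selected cubes have distinct parents;
     a bad tuple would therefore be in [Bs] and its first parent in [Del]. *)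
  pose b : {ffun 'I_v -> I} * {ffun 'I_v -> P} := ([ffun i => T i], [ffun i => s (T i)]).
  have bBs : b \in Bs.
    rewrite !inE; apply/andP; split; last first.
      by apply/forallP => i; rewrite !ffunE.
    apply/andP; split.
      apply/injectiveP => i i'; rewrite !ffunE => Tii'; apply: cinj.
      by rewrite (HT i).2 (HT i').2 Tii'.
    move: cbad; congr (is_true (bad _)).
    apply/funext => i; apply/funext => j.
    by rewrite (HT i).2 !ffunE.
  have /negP := (HT i0).1; apply.
  by apply/imsetP; exists b => //; rewrite ffunE.
Qed.

(** * Grid cells, thin sets and one stage of the construction *)

(** Cells are closed: nested cells then have a common point, and the endpoint [eta] lies in the last
    cell. *)
Definition in_cell (R : realType) (eta : R) (G : nat) (x : R) (a : nat) : Prop :=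
  a%:R * (eta / G%:R) <= x <= a.+1%:R * (eta / G%:R).

Definition cell (R : realType) (eta : R) (G d : nat) (c : 'I_d -> nat) :
    set 'rV[R]_d :=
  [set x | forall j, in_cell eta G (x 0 j) (c j)].

(* [W] has upper Minkowski dimension at most [d - m], in the sharp form of a
   bound [C * G ^ (d - m)] on the number of cubes of each grid that meet it. *)
Definition thin (R : realType) (eta : R) (d m : nat) (W : set 'rV[R]_d) : Prop :=
  exists C : nat, forall G : nat, (0 < G)%N ->
    (#|[set c : {ffun 'I_d -> 'I_G} |
        `[< cell eta G (fun j => c j) `&` W !=set0 >]]%SET| <= C * G ^ (d - m))%N.

Lemma exists_large_power (R : realType) (D x : R) : 0 < D ->
  exists t : nat, (2 < t)%N /\ x <= t%:R `^ D.
Proof.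
move=> D0; have [x0|x0] := leP x 0.
  by exists 3%N; split => //; apply: le_trans x0 (powR_ge0 _ _).
pose t := (Num.truncn (x `^ D^-1)).+3.
exists t; split => //.
have xt : x `^ D^-1 <= t%:R.
  by rewrite ltW // (lt_le_trans (truncnS_gt _)) // ler_nat /t !ltnS !leqW.
have -> : x = (x `^ D^-1) `^ D by rewrite -powRrM mulVf ?gt_eqF // powRr1 // ltW.
by apply: ge0_ler_powR => //; rewrite ?nnegrE ?powR_ge0 // ltW.
Qed.

(** With [A = t ^ m] and [B = L * t ^ e], where [e = n (v - 1) - m], one has
    [B ^ m = L ^ m * A ^ e], which is what the count of bad tuples requires. Moreover
    [N * A * B = N * L * t ^ (n (v - 1))], and its power [s] is dominated by [A ^ n = t ^ (m n)] for
    large [t], since [s < m / (v - 1)]. *)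
Lemma exists_stage (R : realType) (eta : R) (m n v N : nat) (s : R)
    (W : set 'rV[R]_(v * n)) :
  (0 < m)%N -> (0 < n)%N -> (1 < v)%N -> (m <= n * (v - 1))%N -> (0 < N)%N ->
  s < m%:R / (v%:R - 1) -> thin eta m W ->
  exists A B, exists ch : {ffun 'I_n -> nat} -> seq {ffun 'I_n -> nat},
    [/\ (1 < A)%N /\ (0 < B)%N,
        (N * A * B)%:R `^ s <= ((A ^ n)./2)%:R :> R,
        forall a : {ffun 'I_n -> nat}, (forall j, a j < N)%N ->
          uniq (ch a) /\ size (ch a) = (A ^ n)./2,
        forall a c, c \in ch a -> forall j, (c j %/ (A * B) = a j)%N
      & (forall a a' c c', c \in ch a -> c' \in ch a' ->
          (forall j, c j %/ B = c' j %/ B)%N -> c = c') /\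
        forall c : 'I_v -> {ffun 'I_n -> nat}, injective c ->
          (forall i, exists a, c i \in ch a) ->
          ~ exists2 y, W y & forall i j,
              in_cell eta (N * A * B) (y 0 (mxvec_index i j)) (c i j)].
Proof.
move=> m0 n0 v1 mle N0 sm [C HC].
pose e := (n * (v - 1) - m)%N.
(* [L] absorbs the thinness constant and the dependence on the current grid. *)
pose L := (2 * C * N ^ (v * n - m)).+1.
have eE : (v * n - m = e + n)%N.
  rewrite /e; have -> : (v * n = n * (v - 1) + n)%N.
    by rewrite -[in X in (_ + X)%N](muln1 n) -mulnDr subnK 1?mulnC // ltnW.
  by rewrite -addnBAC.
pose s' := Num.max s 0.
have v1R : 0 < v%:R - 1 :> R by rewrite subr_gt0 ltr1n.
have m0R : 0 < m%:R :> R by rewrite ltr0n.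
have n0R : 0 < n%:R :> R by rewrite ltr0n.
have s'lt : s' < m%:R / (v%:R - 1) by rewrite gt_max sm divr_gt0.
(* The surplus in the exponent of [t], which beats all constants. *)
have D0 : 0 < (m * n)%:R - (n * (v - 1))%:R * s' :> R.
  rewrite subr_gt0 !natrM natrB 1?ltnW // mulrC [ltRHS]mulrC -mulrCA.
  by rewrite ltr_pM2l // -ltr_pdivlMr.
have [t [t2 Ht]] := exists_large_power (3 * (N * L)%:R `^ s') D0.
pose A := (t ^ m)%N; pose B := (L * t ^ e)%N.
have t0 : (0 < t)%N by lia.
have A1 : (1 < A)%N by rewrite -(expn0 t) ltn_exp2l // ltnW // ltnW.
have An : (2 <= A ^ n)%N.
  by rewrite (leq_trans A1) // -[leqLHS]expn1 leq_exp2l.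
have B0 : (0 < B)%N by rewrite muln_gt0 /= expn_gt0 t0.
have v0 : (0 < v)%N by rewrite ltnW.
have G0 : (0 < N * A * B)%N.
  by rewrite (muln_gt0 _ B) (muln_gt0 N A) N0 B0 (ltnW A1).
pose bad (c : 'I_v -> 'I_n -> nat) : bool := `[< exists2 y, W y & forall i j,
              in_cell eta (N * A * B) (y 0 (mxvec_index i j)) (c i j) >].
have [|ch [ch1 ch2 ch3 ch4]] := @select_subcubes n v N A B bad v0 B0.
  have [g gK Kg] : exists2 g, cancel (uncurry (@mxvec_index v n)) g &
      cancel g (uncurry (@mxvec_index v n)).
    have [g gK Kg] := curry_mxvec_bij v n.
    by exists g => // x; [apply: gK|apply: Kg].
  pose flat (b : {ffun 'I_v -> {ffun 'I_n -> 'I_(N * A * B)}}) :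
     {ffun 'I_(v * n) -> 'I_(N * A * B)} := [ffun k => b (g k).1 (g k).2].
  have flat_inj : injective flat.
    move=> b b' /ffunP bb'; apply/ffunP => i; apply/ffunP => j.
    by have := bb' (mxvec_index i j); rewrite !ffunE (gK (i, j)).
  apply: (@leq_trans (C * (N * A * B) ^ (v * n - m) * 2)).
    rewrite leq_mul2r /=; apply: leq_trans (HC _ G0).
    rewrite -(card_imset _ flat_inj); apply: subset_leq_card.
    apply/fintype.subsetP => _ /imsetP[b + ->]; rewrite !finset.in_set => /asboolP[y Wy yb].
    apply/asboolP; exists y; split => // k.
    by rewrite ffunE -[in y 0 k](Kg k); case: (g k) => i j; apply: yb.
  rewrite -[((B ^ n) ^ v)%N]expnM.
  have -> : (n * v = (v * n - m) + m)%N.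
    by rewrite subnK 1?mulnC // (leq_trans mle) // leq_mul2l leq_subr orbT.
  rewrite expnD !expnMn mulnA mulnAC !mulnA.
  have -> : (A ^ (v * n - m) = A ^ e * A ^ n)%N by rewrite eE expnD.
  have -> : ((t ^ e) ^ m = A ^ e)%N by rewrite -!expnM mulnC.
  have L1 : (2 * C * N ^ (v * n - m) <= L ^ m)%N.
    by rewrite (@leq_trans L) // -[leqLHS]expn1 leq_pexp2l.
  move: L1; generalize (N ^ (v * n - m))%N (L ^ m)%N (A ^ e)%N (A ^ n)%N
    (L ^ (v * n - m))%N ((t ^ e) ^ (v * n - m))%N => x w a b y z L1.
  have -> : (C * x * (a * b) * 2 * y * z = (2 * C * x) * (a * b * y * z))%N by ring.
  have -> : (b * y * z * w * a = w * (a * b * y * z))%N by ring.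
  by rewrite leq_mul2r L1 orbT.
exists A, B, ch; split => //.
  have G1 : 1 <= (N * A * B)%:R :> R by rewrite ler1n.
  apply: (@le_trans _ _ ((N * A * B)%:R `^ s')).
    by apply: ler_powR => //; rewrite le_max lexx.
  have -> : (N * A * B = N * L * t ^ (n * (v - 1)))%N.
    rewrite -[in RHS](subnKC mle) expnD -/e /A /B; ring.
  rewrite natrM powRM // natrX -powR_mulrn // -powRrM.
  (* An integer [k >= 2] satisfies [k / 3 <= k./2]; hence the factor 3 in the choice of [t]. *)
  apply: (@le_trans _ _ ((A ^ n)%:R / 3)); last first.
    rewrite ler_pdivrMr // -natrM ler_nat.
    have := odd_double_half (A ^ n); move: An; rewrite -addnn; lia.
  rewrite ler_pdivlMr // mulrAC [in leLHS]mulrC -ler_pdivlMl; last first.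
    by rewrite powR_gt0 // ltr0n.
  rewrite mulrC; apply: le_trans Ht _.
  rewrite -expnM natrX -powR_mulrn // powRB; last by apply/implyP; rewrite pnatr_eq0 -lt0n.
  by rewrite mulrC.
by split=> // c cinj /(ch4 c cinj)/asboolPn.
Qed.

Lemma derivable_along (R : realType) (d m : nat) (f : 'rV[R]_d -> 'rV[R]_m)
    (z w : 'rV[R]_d) (t : R) (i : 'I_m) : differentiable f (z + t *: w) ->
  is_derive t (1 : R) (fun t => f (z + t *: w) 0 i)
    ((w *m 'J f (z + t *: w)) 0 i).
Proof.
move=> df; have fder : derivable f (z + t *: w) w by exact: diff_derivable.
have : (h^-1 *: ((f \o shift (z + t *: w)) (h *: w) - f (z + t *: w))) 0 i
    @[h --> (0:R)^'] --> (w *m 'J f (z + t *: w)) 0 i.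
  rewrite -deriveEjacobian //.
  exact: (continuous_cvg _ (@coord_continuous R 1 m 0 i _) fder).
set F := (X in X @ _ --> _ -> _) => FJ.
have FE : (fun h : R => h^-1 *: (((fun t => f (z + t *: w) 0 i) \o shift t) (h *: 1)
    - f (z + t *: w) 0 i)) = F.
  apply/funext => h; rewrite /F /=.
  have -> : h *: 1 + t = h + t by rewrite /GRing.scale /= mulr1.
  by rewrite scalerDl addrCA !mxE.
split; first by rewrite /derivable FE; apply/cvg_ex; eexists; exact: FJ.
by rewrite /derive FE; exact/cvg_lim.
Qed.

Lemma ball_mxvec (R : realType) (p q : nat) (M M' : 'M[R]_(p, q)) (e : R) :
  ball (mxvec M) e (mxvec M') -> forall i j, `|M' i j - M i j| < e.
Proof.
by move=> [_ h] i j; move: (h 0 (mxvec_index i j)); rewrite !mxvecE /ball /= distrC.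
Qed.

Lemma mulmx_entry_dist (R : realType) (d m : nat) (w : 'rV[R]_d)
    (M M' : 'M[R]_(d, m)) (i : 'I_m) (r e : R) :
  (forall k, `|w 0 k| <= r) -> (forall k, `|M k i - M' k i| <= e) ->
  `|(w *m M) 0 i - (w *m M') 0 i| <= d%:R * (r * e).
Proof.
move=> wr Me; rewrite !mxE -sumrB (le_trans (ler_norm_sum _ _ _)) //.
rewrite mulr_natl -[d in leRHS]card_ord -sumr_const.
by apply: ler_sum => k _; rewrite -mulrBr normrM ler_pM.
Qed.

(** Mean value theorem on the segment from [z'] to [z], applied to each coordinate of [f] minus its
    linearisation at [y0]; continuity of the Jacobian at [y0] makes the derivative of this
    difference small. *)
Lemma strict_differentiability (R : realType) (d m : nat)
    (f : 'rV[R]_d -> 'rV[R]_m) (y0 : 'rV[R]_d) (e : R) :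
  (forall x, differentiable f x) ->
  {for y0, continuous (fun x => mxvec ('J f x))} -> 0 < e ->
  exists2 rho : R, 0 < rho & forall z z' : 'rV[R]_d,
    (forall k, `|z 0 k - y0 0 k| < rho) -> (forall k, `|z' 0 k - y0 0 k| < rho) ->
    forall i r, 0 <= r -> (forall k, `|z 0 k - z' 0 k| <= r) ->
    `|f z 0 i - f z' 0 i - ((z - z') *m 'J f y0) 0 i| <= e * r.
Proof.
move=> df Jcont e0.
(* The error is a sum of [d] entries; dividing by [d.+1] also covers [d = 0]. *)
have e'0 : 0 < e / d.+1%:R by rewrite divr_gt0.
have /nbhs_ballP[rho /= rho0 Hrho] := Jcont _ (nbhsx_ballx _ _ e'0).
have Jclose (x : 'rV[R]_d) : (forall k, `|x 0 k - y0 0 k| < rho) -> forall k i,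
    `|'J f x k i - 'J f y0 k i| <= e / d.+1%:R.
  move=> xrho k i; have xb : ball y0 rho x.
    by split => // a b; rewrite ord1 /ball /= distrC.
  by apply/ltW/ball_mxvec; exact: Hrho.
exists rho => // z z' zr zr' i r r0 rP.
pose w := z - z'.
pose phi t := f (z' + t *: w) 0 i - t * (w *m 'J f y0) 0 i.
pose dphi t := (w *m 'J f (z' + t *: w)) 0 i - (w *m 'J f y0) 0 i.
have phiD t : is_derive t (1 : R) phi (dphi t).
  apply: is_deriveB; first exact: derivable_along.
  have -> : (fun t => t * (w *m 'J f y0) 0 i) = (w *m 'J f y0) 0 i \*: id.
    by apply/funext => x; rewrite mulrC.
  by apply: is_derive_eq; rewrite /GRing.scale /= mulr1.
have phi_cont : {within `[0, 1], continuous phi}.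
  by apply: derivable_within_continuous => x _; have [] := phiD x.
have [c] := MVT ltr01 (fun x _ => phiD x) phi_cont.
rewrite in_itv /= => /andP[c0 c1]; rewrite subr0 mulr1.
rewrite /phi scale1r scale0r addr0 mul1r mul0r subr0 /w subrKC => phiE.
rewrite addrAC phiE /dphi -/w.
(* The intermediate point stays in the sup-norm ball by convexity. *)
have cr k : `|(z' + c *: w) 0 k - y0 0 k| < rho.
  rewrite !mxE.
  have -> : z' 0 k + c * (z 0 k - z' 0 k) - y0 0 k =
    c * (z 0 k - y0 0 k) + (1 - c) * (z' 0 k - y0 0 k) by ring.
  apply: le_lt_trans (ler_normD _ _) _; rewrite !normrM.
  rewrite (gtr0_norm c0) (@gtr0_norm _ (1 - c)) ?subr_gt0 //.
  have -> : rho = c * rho + (1 - c) * rho by ring.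
  by rewrite ltrD // ltr_pM2l // subr_gt0.
apply: (@le_trans _ _ (d%:R * (r * (e / d.+1%:R)))).
  by apply: mulmx_entry_dist => // k; [rewrite !mxE|exact: Jclose].
have -> : d%:R * (r * (e / d.+1%:R)) = (e * r) * (d%:R / d.+1%:R) :> R by ring.
by rewrite ler_piMr ?mulr_ge0 ?(ltW e0) // ler_pdivrMr // mul1r ler_nat.
Qed.

Lemma entries_bounded (R : realType) (p q : nat) (M : 'M[R]_(p, q)) :
  exists2 K : R, 0 <= K & forall i j, `|M i j| <= K.
Proof.
exists (\sum_i \sum_j `|M i j|).
  by apply: sumr_ge0 => i _; apply: sumr_ge0.
move=> i j; rewrite (bigD1 i) //= (bigD1 j) //= -addrA lerDl addr_ge0 //.
  exact: sumr_ge0.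
by apply: sumr_ge0 => k _; exact: sumr_ge0.
Qed.

(* A vector almost in the kernel of [J] is controlled by its coordinates
   outside the range of [g], the rows of an invertible minor of [J]. *)
Lemma near_kernel_bound (R : realType) (d m : nat) (J : 'M[R]_(d, m)) :
  \rank J = m ->
  exists (g : 'I_m -> 'I_d) (L e : R), [/\ injective g, 0 <= L, 0 < e &
    forall w : 'rV[R]_d,
      (forall D, 0 <= D -> (forall k, `|w 0 k| <= D) ->
         forall i, `|(w *m J) 0 i| <= e * D) ->
      forall r, 0 <= r -> (forall k, k \notin codom g -> `|w 0 k| <= r) ->
      forall k, `|w 0 k| <= L * r].
Proof.
move=> Jrank.
have Jfull : row_full J by rewrite /row_full Jrank.
pose g : 'I_m -> 'I_d := fullrankfun Jfull.
have ginj : injective g by apply: fullrankfun_inj.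
pose A := rowsub g J.
have Aunit : A \in unitmx by apply: fullrowsub_unit.
have [K K0 KP] := entries_bounded J.
have [K' K'0 K'P] := entries_bounded (invmx A).
(* Small enough that inverting the minor turns an error [e * D] into at most [D / 2], which can be
   absorbed. *)
pose e : R := (2 * (m%:R * K' + 1))^-1.
have mK'0 : 0 < m%:R * K' + 1 by rewrite ltr_wpDl ?mulr_ge0.
have e0 : 0 < e by rewrite invr_gt0 mulr_gt0.
pose M := m%:R * K' * (d%:R * K).
have M0 : 0 <= M by rewrite !mulr_ge0.
have L0 : 0 <= 1 + 2 * M by rewrite addr_ge0 // mulr_ge0.
exists g, (1 + 2 * M), e; split => // w wJ r r0 offg.
pose U : R := \big[Num.max/0]_(l < m) `|w 0 (g l)|.
have UP l : `|w 0 (g l)| <= U by apply: (le_bigmax _ (fun l => `|w 0 (g l)|)).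
have U0 : 0 <= U by apply: bigmax_ge_id.
pose D := Num.max U r.
have D0 : 0 <= D by rewrite le_max U0.
have wD k : `|w 0 k| <= D.
  have [/codomP[l ->]|kg] := boolP (k \in codom g); first by rewrite le_max UP.
  by rewrite le_max offg ?orbT.
pose u := \row_(l < m) w 0 (g l).
have uA i : `|(u *m A) 0 i| <= e * D + d%:R * K * r.
  (* The product with the minor is the full product minus the remaining rows, which only meet
     coordinates bounded by [r]. *)
  have -> : (u *m A) 0 i = (w *m J) 0 i
      - \sum_(k < d | k \notin codom g) w 0 k * J k i.
    rewrite !mxE (bigID (mem (codom g))) /= addrK.
    rewrite (eq_bigl (mem (g @: finset.setT)%SET)); last first.
      move=> k; rewrite /= [RHS]inE; apply/codomP/imsetP => [[l ->]|[l _ ->]].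
        by exists l.
      by exists l.
    rewrite big_imset /=; last by move=> ? ? _ _; exact: ginj.
    by apply: eq_big => [l|l _]; rewrite ?finset.in_setT // !mxE.
  apply: le_trans (ler_normB _ _) _; rewrite lerD ?wJ //.
  apply: le_trans (ler_norm_sum _ _ _) _.
  apply: (@le_trans _ _ (\sum_(k < d) r * K)); last first.
    by rewrite sumr_const card_ord -[_ *+ d]mulr_natl [r * K]mulrC mulrA.
  rewrite big_mkcond ler_sum //= => k _; case: ifPn => kg; last by rewrite mulr_ge0.
  by rewrite normrM ler_pM // offg.
have uE : u = (u *m A) *m invmx A by rewrite mulmxK.
have Ule : U <= m%:R * K' * (e * D + d%:R * K * r).
  apply/bigmax_leP; split.
    by rewrite !mulr_ge0 // addr_ge0 // !mulr_ge0 // ltW.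
  move=> l _; have -> : w 0 (g l) = u 0 l by rewrite mxE.
  rewrite uE mxE; apply: le_trans (ler_norm_sum _ _ _) _.
  apply: (@le_trans _ _ (\sum_(k < m) (e * D + d%:R * K * r) * K')).
    by apply: ler_sum => k _; rewrite normrM ler_pM.
  by rewrite sumr_const card_ord -[_ *+ m]mulr_natl [_ * K']mulrC mulrA.
have eD : m%:R * K' * (e * D) <= D / 2.
  have eE : e * (m%:R * K' + 1) = 2^-1 by rewrite /e invfM mulfVK ?gt_eqF.
  have -> : D / 2 = m%:R * K' * (e * D) + e * D by rewrite -eE; ring.
  by rewrite lerDl mulr_ge0 // ltW.
suff DL : D <= (1 + 2 * M) * r by move=> k; apply: le_trans (wD k) DL.
have Mr : 0 <= M * r by rewrite mulr_ge0.
have {}Ule : U <= D / 2 + M * r.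
  apply: le_trans Ule _; rewrite mulrDr lerD //.
  by rewrite /M -!mulrA.
(* Either [D = r], or [D = U] and the term [D / 2] is absorbed by the left side. *)
rewrite mulrDl mul1r -mulrA /D; have [Ur|rU] := leP U r.
  by rewrite lerDl mulr_ge0.
have DU : D = U by rewrite /D max_l // ltW.
rewrite DU in Ule; lra.
Qed.

(* Near [y0] the zero set is a Lipschitz graph over the coordinates outside
   the range of [g]. *)
Lemma zero_set_lipschitz (R : realType) (d m : nat)
    (f : 'rV[R]_d -> 'rV[R]_m) (y0 : 'rV[R]_d) :
  (forall x, differentiable f x) ->
  {for y0, continuous (fun x => mxvec ('J f x))} -> \rank ('J f y0)^T = m ->
  exists (g : 'I_m -> 'I_d) (L rho : R), [/\ injective g, 0 <= L, 0 < rho &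
    forall z z' : 'rV[R]_d,
    (forall k, `|z 0 k - y0 0 k| < rho) -> (forall k, `|z' 0 k - y0 0 k| < rho) ->
    f z = 0 -> f z' = 0 ->
    forall r, 0 <= r -> (forall k, k \notin codom g -> `|z 0 k - z' 0 k| <= r) ->
    forall k, `|z 0 k - z' 0 k| <= L * r].
Proof.
move=> df Jcont; rewrite mxrank_tr => Jrank.
have [g [L [e [ginj L0 e0 gP]]]] := near_kernel_bound Jrank.
have [rho rho0 Hrho] := strict_differentiability df Jcont e0.
exists g, L, rho; split => // z z' zr zr' fz fz' r r0 offg k.
have wE l : z 0 l - z' 0 l = (z - z') 0 l by rewrite !mxE.
(* As [f] vanishes at both points, strict differentiability bounds the linear part at [z - z']
   itself. *)
rewrite wE; apply: gP r0 _ k => [D D0 wD i|l lg].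
  have {}wD l : `|z 0 l - z' 0 l| <= D by rewrite wE.
  have := Hrho z z' zr zr' i D D0 wD.
  by rewrite fz fz' subrr sub0r normrN.
by rewrite -wE offg.
Qed.

(** * Counting grid cubes; a countable cover of the zeros by thin pieces *)

Lemma eq_mod_close (x y P : nat) :
  (x = y %[mod P] -> x < y + P -> y < x + P -> x = y)%N.
Proof.
move=> e; have := divn_eq x P; have := divn_eq y P; rewrite e.
generalize (x %/ P)%N (y %/ P)%N (y %% P)%N => a b c -> -> h1 h2.
have h1' : (a * P < b.+1 * P)%N by lia.
have h2' : (b * P < a.+1 * P)%N by lia.
move: h1' h2'; rewrite !ltn_mul2r => /andP[_ h1'] /andP[_ h2'].
by congr (_ * _ + _)%N; lia.
Qed.

(** A cube meeting [W] is determined by its indices off the range of [g] together with the residues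
    modulo [P] of the other [m] indices: two such cubes that agree off the range contain points of
    [W] within one mesh there, hence within [L] meshes everywhere. This leaves [P ^ m * G ^ (d - m)]
    possibilities. *)
Lemma lipschitz_graph_thin (R : realType) (eta : R) (d m : nat)
    (W : set 'rV[R]_d) (g : 'I_m -> 'I_d) (L : R) :
  0 < eta -> injective g -> 0 <= L ->
  (forall z z', W z -> W z' -> forall r, 0 <= r ->
    (forall k, k \notin codom g -> `|z 0 k - z' 0 k| <= r) ->
    forall k, `|z 0 k - z' 0 k| <= L * r) ->
  thin eta m W.
Proof.
move=> eta0 ginj L0 HW.
(* [P] exceeds [1 + L], the largest possible gap between two such indices. *)
pose P := (Num.truncn L).+3.
exists (P ^ m)%N => G G0.
pose h := eta / G%:R; have h0 : 0 < h by rewrite divr_gt0 ?ltr0n.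
set S := [set c | _]%SET.
have GS (c : 'I_G) : (c %% P < G)%N.
  by rewrite (leq_ltn_trans (leq_mod _ _)).
pose red (c : {ffun 'I_d -> 'I_G}) : {ffun 'I_d -> 'I_G} :=
  [ffun k => if k \in codom g then Ordinal (GS (c k)) else c k].
pose F (k : 'I_d) := [pred a : 'I_G | (k \in codom g) ==> (a < P)%N].
have red_close (c c' : {ffun 'I_d -> 'I_G}) : c \in S -> c' \in S ->
    (forall k, k \notin codom g -> c k = c' k) -> forall k, (c k < c' k + P)%N.
  rewrite !finset.in_set => /asboolP[z [zc Wz]] /asboolP[z' [zc' Wz']] cc' k.
  have off l : l \notin codom g -> `|z 0 l - z' 0 l| <= h.
    move=> lg; have := zc l; have := zc' l; rewrite (cc' _ lg) /in_cell -/h.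
    rewrite -natr1 mulrDl mul1r => /andP[a1 a2] /andP[b1 b2].
    by rewrite ler_distl; apply/andP; split; lra.
  have := HW z z' Wz Wz' h (ltW h0) off k.
  have := zc k; have := zc' k; rewrite /in_cell -/h -!natr1 !mulrDl !mul1r.
  move=> /andP[a1 a2] /andP[b1 b2]; rewrite ler_distl => /andP[_ zz].
  have : (c k)%:R * h <= ((c' k)%:R + 1 + L) * h by rewrite !mulrDl mul1r; lra.
  rewrite ler_pM2r // => ck.
  have Lt : L < (Num.truncn L).+1%:R by apply: truncnS_gt.
  have : (c k)%:R < (c' k + P)%:R :> R.
    apply: le_lt_trans ck _; rewrite /P natrD -addrA ltrD2l.
    by rewrite -natr1 -natr1 -[in ltRHS]natr1; move: Lt; rewrite -natr1; lra.
  by rewrite ltr_nat.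
have red_inj : {in S &, injective red}.
  move=> c c' cS c'S e.
  have eoff k : k \notin codom g -> c k = c' k.
    by move=> /negbTE kg; have /ffunP/(_ k) := e; rewrite !ffunE kg.
  apply/ffunP => k; have [kg|/eoff //] := boolP (k \in codom g).
  apply/val_inj => /=.
  have /ffunP/(_ k)/(congr1 val) := e; rewrite !ffunE kg /= => ek.
  have c1 := red_close c c' cS c'S eoff k.
  have c2 := red_close c' c c'S cS (fun k kg => esym (eoff k kg)) k.
  exact: eq_mod_close ek c1 c2.
rewrite -(card_in_imset red_inj).
apply: (@leq_trans #|family F|).
  apply: subset_leq_card; apply/fintype.subsetP => _ /imsetP[c _ ->].
  apply/familyP => k; rewrite inE; apply/implyP => kg.
  by rewrite ffunE kg /= ltn_mod.
rewrite card_family foldrE big_map big_enum /= (bigID (mem (codom g))) /=.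
have cg : #|[pred k | k \in codom g]| = m.
  by rewrite -[RHS]card_ord -(card_codom ginj); apply: eq_card.
apply: leq_mul.
  apply: (@leq_trans (\prod_(k in codom g) P)); last first.
    by rewrite prod_nat_const cg.
  apply: leq_prod => k kg.
  have inj : {in F k &, injective (fun a : 'I_G => inord a : 'I_P)}.
    move=> a b; rewrite !inE kg => aP bP /(congr1 val).
    by rewrite /= !inordK // => /val_inj.
  by rewrite -(card_in_imset inj) -[leqRHS]card_ord max_card.
apply: (@leq_trans (\prod_(k < d | k \notin codom g) G)).
  by apply: leq_prod => k _; rewrite -[leqRHS]card_ord max_card.
rewrite prod_nat_const; have := cardC [pred k | k \in codom g].
rewrite cg card_ord => /(congr1 (subn^~ m)); rewrite addKn => cC.
rewrite -[in X in (_ <= X)%N]cC leq_eqVlt; apply/orP; left; apply/eqP.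
by congr (_ ^ _)%N; exact: eq_card.
Qed.

Lemma cell_exists (R : realType) (eta : R) (d G : nat) (y : 'rV[R]_d) :
  0 < eta -> (0 < G)%N -> (forall k, 0 <= y 0 k) ->
  cell eta G [ffun k => Num.truncn (y 0 k / (eta / G%:R))] y.
Proof.
move=> eta0 G0 y0 k.
have h0 : 0 < eta / G%:R by rewrite divr_gt0 ?ltr0n.
have yk0 : 0 <= y 0 k / (eta / G%:R) by rewrite divr_ge0 // ltW.
have /andP[t1 t2] := truncn_itv yk0.
by rewrite /in_cell ffunE -ler_pdivlMr // t1 -ler_pdivrMr // ltW.
Qed.

Lemma mesh_small (R : realType) (eta rho : R) : 0 < eta -> 0 < rho ->
  exists2 G0 : nat, (0 < G0)%N & forall G, (G0 <= G)%N -> eta / G%:R < rho.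
Proof.
move=> eta0 rho0; exists (Num.truncn (eta / rho)).+1 => // G GG.
have G0 : (0 < G)%N by apply: leq_trans GG.
rewrite ltr_pdivrMr ?ltr0n // mulrC -ltr_pdivrMr //.
by apply: lt_le_trans (truncnS_gt _) _; rewrite ler_nat.
Qed.

Lemma in_cell_dist (R : realType) (eta : R) (G : nat) (x y : R) (a : nat) :
  in_cell eta G x a -> in_cell eta G y a -> `|x - y| <= eta / G%:R.
Proof.
rewrite /in_cell -natr1 mulrDl mul1r => /andP[? ?] /andP[? ?].
by rewrite ler_distl; apply/andP; split; lra.
Qed.

Lemma thin_set0 (R : realType) (eta : R) (d m : nat) : thin eta m (@set0 'rV[R]_d).
Proof.
exists 0%N => G _; rewrite mul0n leqn0 cards_eq0; apply/eqP/setP => c.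
rewrite finset.in_set finset.in_set0; apply/negbTE/negP => /asboolP[z [_ []]].
Qed.

Lemma thin_setU (R : realType) (eta : R) (d m : nat) (V W : set 'rV[R]_d) :
  thin eta m V -> thin eta m W -> thin eta m (V `|` W).
Proof.
move=> [C HC] [D HD]; exists (C + D)%N => G G0.
rewrite mulnDl (leq_trans _ (leq_add (HC _ G0) (HD _ G0))) //.
rewrite (leq_trans _ (leq_card_setU _ _)) // subset_leq_card //.
apply/fintype.subsetP => c; rewrite finset.in_setU !finset.in_set.
move=> /asboolP[z [zc [Vz|Wz]]]; apply/orP; [left|right];
by apply/asboolP; exists z.
Qed.

Lemma thin_bigcup_ord (R : realType) (eta : R) (d m : nat)
    (Z : nat -> set 'rV[R]_d) k :
  (forall j, thin eta m (Z j)) -> thin eta m (\bigcup_(j < k) Z j).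
Proof.
move=> HZ; elim: k => [|k IH]; first by rewrite bigcup_mkord big_ord0; exact: thin_set0.
by rewrite bigcup_mkord big_ord_recr /= -bigcup_mkord; exact: thin_setU.
Qed.

(** The neighbourhood on which the zero set is a Lipschitz graph is shrunk to a grid cell, because
    cells are described by integers and so form a countable family. *)
Lemma thin_zero_piece (R : realType) (eta : R) (d m : nat)
    (f : 'rV[R]_d -> 'rV[R]_m) (y : 'rV[R]_d) :
  0 < eta -> class_C 2 f -> (forall k, 0 <= y 0 k) ->
  \rank ('J f y)^T = m ->
  exists G (c : {ffun 'I_d -> nat}), cell eta G c y /\
    thin eta m ([set z | f z = 0] `&` cell eta G c).
Proof.
move=> eta0 [df [dJ _]] y0 rk.
have Jcont : {for y, continuous (fun x => mxvec ('J f x))}.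
  exact: differentiable_continuous.
have [g [L [rho [ginj L0 rho0 H]]]] := zero_set_lipschitz df Jcont rk.
have [G G0 /(_ G (leqnn G)) Grho] := mesh_small eta0 rho0.
pose c : {ffun 'I_d -> nat} := [ffun k => Num.truncn (y 0 k / (eta / G%:R))].
have yc : cell eta G c y by apply: cell_exists.
exists G, c; split => //; apply: (lipschitz_graph_thin eta0 ginj L0).
have near z : cell eta G c z -> forall k, `|z 0 k - y 0 k| < rho.
  by move=> zc k; apply: le_lt_trans (in_cell_dist (zc k) (yc k)) Grho.
by move=> z z' [fz zc] [fz' zc'] r; apply: H => //; exact: near.
Qed.

Lemma countable_thin_cover (R : realType) (eta : R) (d m : nat)
    (Q : countType) (f : Q -> 'rV[R]_d -> 'rV[R]_m) :
  0 < eta -> (forall q, class_C 2 (f q)) ->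
  (forall q y, cube eta y -> f q y = 0 -> \rank ('J (f q) y)^T = m) ->
  exists2 Z : nat -> set 'rV[R]_d, forall j, thin eta m (Z j) &
    forall q y, cube eta y -> f q y = 0 -> exists j, Z j y.
Proof.
move=> eta0 f_C2 f_rank.
pose piece (p : Q * nat * {ffun 'I_d -> nat}) :=
  [set z | f p.1.1 z = 0] `&` cell eta p.1.2 p.2.
(* Pieces that are not thin are replaced by [set0]; each zero in the cube still lies in a thin
   one. *)
pose Z j := if unpickle j is Some p then
  if `[< thin eta m (piece p) >] then piece p else set0 else set0.
exists Z => [j|q y ycube fy].
  rewrite /Z; case: unpickle => [p|]; last exact: thin_set0.
  by case: ifPn => [/asboolP //|_]; exact: thin_set0.
have y0 k : 0 <= y 0 k by have /andP[] := ycube k.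
have [G [c [yc Hthin]]] := thin_zero_piece eta0 (f_C2 q) y0 (f_rank q y ycube fy).
exists (pickle (q, G, c)); rewrite /Z pickleK ifT //; exact/asboolP.
Qed.

(** * Branches of trees and mass distribution *)

(** Dependent choice, with [P] as the invariant carried along the branch. *)
Lemma exists_branch (X : choiceType) (ch : nat -> X -> seq X)
    (P : nat -> X -> Prop) (k0 : nat) (a0 : X) :
  P k0 a0 -> (forall k a, P k a -> exists2 c, c \in ch k a & P k.+1 c) ->
  exists b : nat -> X, b 0 = a0 /\
    forall j, P (k0 + j)%N (b j) /\ b j.+1 \in ch (k0 + j)%N (b j).
Proof.
move=> P0 Pch.
pose next k a := xget a [set c | c \in ch k a /\ P k.+1 c].
have nextP k a : P k a -> next k a \in ch k a /\ P k.+1 (next k a).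
  by move=> /Pch[c cch Pc]; rewrite /next; case: xgetP => // /(_ c)[].
pose b := fix b j := if j is j'.+1 then next (k0 + j')%N (b j') else a0.
have bP j : P (k0 + j)%N (b j).
  by elim: j => [|j IH]; rewrite ?addn0 //= addnS; have [] := nextP _ _ IH.
by exists b; split => // j; split => //; have [] := nextP _ _ (bP j).
Qed.

Fixpoint descendants (X : Type) (ch : nat -> X -> seq X) (j k : nat) (a : X) :=
  if j is j'.+1 then flatten [seq descendants ch j' k.+1 c | c <- ch k a]
  else [:: a].

(* Mass distribution: the hit nodes carry a mass less than that of the root,
   so at each step some child has less than its own mass hit below it. *)
Lemma branch_avoiding_hits (R : realType) (X : choiceType)
    (ch : nat -> X -> seq X) (valid : nat -> X -> Prop) (nu : nat -> R)
    (hit : nat -> X -> bool) (K : nat -> nat) (k0 : nat) (a0 : X) :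
  (forall k, 0 < nu k) ->
  (forall k a, valid k a -> nu k = (size (ch k a))%:R * nu k.+1) ->
  (forall k a c, valid k a -> c \in ch k a -> valid k.+1 c) ->
  valid k0 a0 -> (forall i, k0 <= K i)%N ->
  (\sum_(0 <= i <oo)
     ((count (hit i) (descendants ch (K i - k0) k0 a0))%:R * nu (K i))%:E
   < (nu k0)%:E)%E ->
  exists b : nat -> X, [/\ b 0 = a0,
    forall j, valid (k0 + j)%N (b j) /\ b j.+1 \in ch (k0 + j)%N (b j)
    & forall i, ~~ hit i (b (K i - k0)%N)].
Proof.
move=> nu0 nuE validS valid0 K0 Hsum.
(* The mass of the nodes of level [K i] below [a] that test [i] hits; it counts as 0 once that level
   has been passed. *)
pose wt i k a : R := if (k <= K i)%N then
  (count (hit i) (descendants ch (K i - k) k a))%:R * nu (K i) else 0.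
have wt0 i k a : 0 <= wt i k a.
  by rewrite /wt; case: ifP => // _; rewrite mulr_ge0 // ltW.
pose w k a := (\sum_(0 <= i <oo) (wt i k a)%:E)%E.
have wt_ch i k a : \sum_(c <- ch k a) wt i k.+1 c <= wt i k a.
  rewrite /wt; case: (ltngtP k (K i)) => kK.
  - rewrite -mulr_suml -natr_sum ler_wpM2r ?(ltW (nu0 _)) // ler_nat.
    have -> : (K i - k = (K i - k.+1).+1)%N by rewrite subnSK.
    by rewrite /= count_flatten -map_comp sumnE big_map.
  - by rewrite big1.
  - by rewrite big1 // mulr_ge0 // ltW.
pose P k a := valid k a /\ (w k a < (nu k)%:E)%E.
have [||b [b0 bP]] := @exists_branch X ch P k0 a0.
- split=> //; rewrite /w; under eq_eseriesr do rewrite /wt K0; exact: Hsum.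
- move=> k a [va wa]; apply: contrapT => Hno.
  have Hc c : c \in ch k a -> ((nu k.+1)%:E <= w k.+1 c)%E.
    move=> cch; rewrite leNgt; apply/negP => wc; apply: Hno; exists c => //.
    by split => //; exact: validS cch.
  move: wa; rewrite ltNge => /negP; apply.
  (* If every child had at least its own mass hit below it, the sum over the children would reach
     the mass of [a]. *)
  apply: (@le_trans _ _ (\sum_(c <- ch k a) w k.+1 c)%E).
    rewrite (nuE k a va) -sum1_size natr_sum mulr_suml -sumEFin.
    rewrite big_seq [leRHS]big_seq; apply: lee_sum => c cch.
    by rewrite mul1r Hc.
  rewrite /w -nneseries_sum; last by move=> c i _; rewrite lee_fin.
  apply: lee_nneseries => [i _ _|i _]; first by apply: sume_ge0 => c _; rewrite lee_fin.
  by rewrite sumEFin lee_fin.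
exists b; split => // [j|i]; first by have [[]] := bP j.
have [[_ wb] _] := bP (K i - k0)%N.
rewrite subnKC // in wb; apply/negP => hb; move: wb; rewrite ltNge => /negP; apply.
(* A hit node of level [K i] has its full mass hit, against the invariant. *)
apply: (@le_trans _ _ (wt i (K i) (b (K i - k0)%N))%:E).
  by rewrite /wt leqnn subnn /= hb addn0 mul1r.
apply: le_trans (nneseries_lim_ge i.+1 _) => //=; last first.
  by move=> j _ _; rewrite lee_fin.
by rewrite big_nat_recr //= leeDr // sume_ge0 // => j _; rewrite lee_fin.
Qed.

(** * The nested selections and their limit set *)

(* [ch k a] lists the cubes of mesh [1 / N k.+1] selected inside the cube [a]
   of mesh [1 / N k]: at most one in each cube of mesh [1 / (N k * A k)]. *)
Record scheme (n : nat) (N A B : nat -> nat)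
    (ch : nat -> {ffun 'I_n -> nat} -> seq {ffun 'I_n -> nat}) : Prop := Scheme {
  scheme_N0 : (0 < N 0)%N;
  scheme_NS : forall k, N k.+1 = (N k * A k * B k)%N;
  scheme_A : forall k, (1 < A k)%N;
  scheme_B : forall k, (0 < B k)%N;
  scheme_size : forall k (a : {ffun 'I_n -> nat}), (forall j, a j < N k)%N ->
    uniq (ch k a) /\ size (ch k a) = (A k ^ n)./2;
  scheme_parent : forall k a c, c \in ch k a ->
    forall j, (c j %/ (A k * B k) = a j)%N;
  scheme_sep : forall k a a' c c', c \in ch k a -> c' \in ch k a' ->
    (forall j, c j %/ B k = c' j %/ B k)%N -> c = c' }.

Definition limit_set (R : realType) (eta : R) (n : nat) (N : nat -> nat)
    (ch : nat -> {ffun 'I_n -> nat} -> seq {ffun 'I_n -> nat}) : set 'rV[R]_n :=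
  [set x | exists k0, forall k, (k0 <= k)%N ->
    exists a c : {ffun 'I_n -> nat}, [/\ forall j, (a j < N k)%N, c \in ch k a &
      cell eta (N k.+1) c x]].

(** Stage [k] treats the first [k] sets [Z j] with an exponent short of the target by [1 / (k + 1)]:
    each [Z j] is treated at all but finitely many stages, and the exponents tend to [m / (v - 1)].
    A choice function on pairs (index, current grid) makes the recursion on [N] possible. *)
Lemma exists_scheme (R : realType) (eta : R) (m n v : nat)
    (Z : nat -> set 'rV[R]_(v * n)) :
  (0 < m)%N -> (0 < n)%N -> (1 < v)%N -> (m <= n * (v - 1))%N ->
  (forall j, thin eta m (Z j)) ->
  exists N A B ch, [/\ @scheme n N A B ch,
    forall k, (N k.+1)%:R `^ (m%:R / (v%:R - 1) - k.+1%:R^-1)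
                <= ((A k ^ n)./2)%:R :> R
    & forall k (c : 'I_v -> {ffun 'I_n -> nat}), injective c ->
        (forall i, exists a, c i \in ch k a) ->
        forall j, (j < k)%N -> ~ exists2 y, Z j y & forall i l,
          in_cell eta (N k.+1) (y 0 (mxvec_index i l)) (c i l)].
Proof.
move=> m0 n0 v1 mle Zthin.
have stage (p : nat * nat) : exists q : nat * nat *
    ({ffun 'I_n -> nat} -> seq {ffun 'I_n -> nat}), (0 < p.2)%N ->
    let: (A, B, ch) := q in let N := p.2 in
    [/\ (1 < A)%N /\ (0 < B)%N,
        (N * A * B)%:R `^ (m%:R / (v%:R - 1) - p.1.+1%:R^-1)
          <= ((A ^ n)./2)%:R :> R,
        forall a : {ffun 'I_n -> nat}, (forall j, a j < N)%N ->
          uniq (ch a) /\ size (ch a) = (A ^ n)./2,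
        forall a c, c \in ch a -> forall j, (c j %/ (A * B) = a j)%N
      & (forall a a' c c', c \in ch a -> c' \in ch a' ->
          (forall j, c j %/ B = c' j %/ B)%N -> c = c') /\
        forall c : 'I_v -> {ffun 'I_n -> nat}, injective c ->
          (forall i, exists a, c i \in ch a) ->
          ~ exists2 y, (\bigcup_(j < p.1) Z j) y & forall i j,
              in_cell eta (N * A * B) (y 0 (mxvec_index i j)) (c i j)].
  (* The triple given for [N = 0] is a dummy value; the recursion starts at 1 and stays positive. *)
  case: p => k N /=; have [->|N0] := posnP N; first by exists (0, 0, fun=> [::])%N.
  have sk : m%:R / (v%:R - 1) - k.+1%:R^-1 < m%:R / (v%:R - 1) :> R.
    by rewrite ltrBlDr ltrDl invr_gt0 ltr0n.
  have [A [B [ch H]]] :=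
    exists_stage m0 n0 v1 mle N0 sk (thin_bigcup_ord k Zthin).
  by exists (A, B, ch).
have [D HD] := choice stage.
pose N := fix N k := if k is k'.+1
  then (N k' * (D (k', N k')).1.1 * (D (k', N k')).1.2)%N else 1%N.
have N0 k : (0 < N k)%N.
  elim: k => //= k IH; have := HD (k, N k) IH; case: (D _) => [[A B] ch] /=.
  by move=> [[A1 B0] _ _ _ _]; rewrite !muln_gt0 IH B0 ltnW.
have {}HD k := HD (k, N k) (N0 k).
exists N, (fun k => (D (k, N k)).1.1), (fun k => (D (k, N k)).1.2),
  (fun k => (D (k, N k)).2).
split; first split => //.
- by move=> k; move: (HD k); case: (D _) => [[A B] ch] /= [[]].
- by move=> k; move: (HD k); case: (D _) => [[A B] ch] /= [[]].
- by move=> k; move: (HD k); case: (D _) => [[A B] ch] /= [].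
- by move=> k; move: (HD k); case: (D _) => [[A B] ch] /= [].
- by move=> k; move: (HD k); case: (D _) => [[A B] ch] /= [_ _ _ _ []].
- by move=> k; move: (HD k) => /=; case: (D _) => [[A B] ch] /= [].
move=> k c cinj cch j jk [y Zy yc].
move: (HD k) yc cch => /=; case: (D _) => [[A B] ch] /= [_ _ _ _ [_ H]] yc cch.
by apply: (H c cinj cch); exists y => //; exists j.
Qed.

Lemma in_cell_div (R : realType) (eta : R) (G D : nat) (x : R) (c : nat) :
  0 < eta -> (0 < G)%N -> (0 < D)%N ->
  in_cell eta (G * D) x c -> in_cell eta G x (c %/ D).
Proof.
move=> eta0 G0 D0.
have G0' : G%:R != 0 :> R by rewrite pnatr_eq0 -lt0n.
have D0' : D%:R != 0 :> R by rewrite pnatr_eq0 -lt0n.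
have Gh : eta / G%:R = D%:R * (eta / (G * D)%:R).
  by rewrite natrM; field; rewrite G0' D0'.
have h0 : 0 <= eta / (G * D)%:R by rewrite divr_ge0 // ltW.
rewrite /in_cell Gh !(mulrA _ _ (eta / (G * D)%:R)) -!natrM => /andP[c1 c2].
apply/andP; split.
  by apply: le_trans c1; rewrite ler_wpM2r // ler_nat leq_divM.
by apply: le_trans c2 _; rewrite ler_wpM2r // ler_nat ltn_ceil.
Qed.

Section SchemeTheory.
Variables (n : nat) (N A B : nat -> nat)
  (ch : nat -> {ffun 'I_n -> nat} -> seq {ffun 'I_n -> nat}).
Hypothesis S : scheme N A B ch.

Lemma scheme_N_gt0 k : (0 < N k)%N.
Proof.
elim: k => [|k IH]; first exact: scheme_N0 S.
by rewrite (scheme_NS S) !muln_gt0 IH (scheme_B S) ltnW ?(scheme_A S).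
Qed.

Lemma scheme_N_double k : (2 * N k <= N k.+1)%N.
Proof.
rewrite (scheme_NS S) -mulnA mulnC leq_mul2l -[2%N]muln1 leq_mul ?orbT //.
  exact: scheme_A S _.
exact: scheme_B S _.
Qed.

Lemma scheme_N_gtn k : (k < N k)%N.
Proof.
elim: k => [|k IH]; first exact: scheme_N_gt0.
by have := scheme_N_double k; lia.
Qed.

Lemma scheme_valid k (a c : {ffun 'I_n -> nat}) : (forall j, a j < N k)%N -> c \in ch k a ->
  (forall j, c j < N k.+1)%N.
Proof.
move=> va cch j; rewrite (scheme_NS S) -mulnA -ltn_divLR.
  by rewrite (scheme_parent S cch).
by rewrite muln_gt0 (scheme_B S) ltnW ?(scheme_A S).
Qed.

Lemma scheme_half_pow k : (0 < n)%N -> (A k ^ n <= 3 * (A k ^ n)./2)%N.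
Proof.
move=> n0; have : (1 < A k ^ n)%N.
  by rewrite (leq_trans (scheme_A S k)) // -[leqLHS]expn1 leq_pexp2l ?(ltnW (scheme_A S k)).
by have := odd_double_half (A k ^ n); rewrite -addnn; lia.
Qed.

Lemma scheme_ch_neq0 k (a : {ffun 'I_n -> nat}) : (0 < n)%N -> (forall j, a j < N k)%N ->
  exists c, c \in ch k a.
Proof.
move=> n0 va; have [_ sz] := scheme_size S va.
have : (0 < A k ^ n)%N by rewrite expn_gt0 ltnW ?(scheme_A S).
have := scheme_half_pow k n0; rewrite -sz; case: (ch k a) => [|c s _ _].
  by rewrite muln0 leqn0 => /eqP->.
by exists c; rewrite mem_head.
Qed.

Lemma scheme_cell_sub (R : realType) (eta : R) k a c (x : 'rV[R]_n) :
  0 < eta -> c \in ch k a -> cell eta (N k.+1) c x -> cell eta (N k) a x.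
Proof.
move=> eta0 cch xc j; rewrite -(scheme_parent S cch j).
apply: in_cell_div => //; first exact: scheme_N_gt0.
  by rewrite muln_gt0 (scheme_B S) ltnW ?(scheme_A S).
by rewrite mulnA -(scheme_NS S).
Qed.

(** Nested closed intervals in each coordinate: the supremum of the left endpoints is below every
    right endpoint. *)
Lemma scheme_branch_point (R : realType) (eta : R) k0 b :
  0 < eta -> (forall j, b j.+1 \in ch (k0 + j)%N (b j)) ->
  exists x : 'rV[R]_n, forall j, cell eta (N (k0 + j)%N) (b j) x.
Proof.
move=> eta0 bch.
pose h j : R := eta / (N (k0 + j)%N)%:R.
pose l i j : R := (b j i)%:R * h j.
pose u i j : R := (b j i).+1%:R * h j.
have step i j : l i j <= l i j.+1 /\ u i j.+1 <= u i j.
  (* The endpoints are monotone because both extreme corners of a child cell lie in the parent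
     cell. *)
  have := @scheme_cell_sub R eta _ _ _ (\row_i l i j.+1) eta0 (bch j).
  have := @scheme_cell_sub R eta _ _ _ (\row_i u i j.+1) eta0 (bch j).
  have h0 : 0 < h j.+1 by rewrite divr_gt0 // ltr0n scheme_N_gt0.
  have ul i' : l i' j.+1 <= u i' j.+1.
    by rewrite ler_wpM2r ?(ltW h0) // ler_nat.
  rewrite -addnS => Hu Hl; split.
    suff /Hl/(_ i) : cell eta (N (k0 + j.+1)) (b j.+1) (\row_i0 l i0 j.+1).
      by rewrite /in_cell mxE => /andP[].
    by move=> i'; rewrite mxE; apply/andP; split; [exact: lexx|exact: ul].
  suff /Hu/(_ i) : cell eta (N (k0 + j.+1)) (b j.+1) (\row_i0 u i0 j.+1).
    by rewrite /in_cell mxE => /andP[].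
  by move=> i'; rewrite mxE; apply/andP; split; [exact: ul|exact: lexx].
have lu i j : l i j <= u i j.
  by rewrite ler_wpM2r ?ler_nat // divr_ge0 ?(ltW eta0).
have lmono i : {homo l i : j j' / (j <= j')%N >-> j <= j'}.
  by apply: homo_leq => [//|x y z|j]; [exact: le_trans|exact: (step i j).1].
have umono i : {homo u i : j j' / (j <= j')%N >-> j' <= j}.
  apply: (homo_leq (r := fun x y => y <= x)) => [//|x y z xy yz|j].
    exact: le_trans yz xy.
  exact: (step i j).2.
have lu' i j j' : l i j <= u i j'.
  have [jj'|/ltnW jj'] := leqP j j'.
    by apply: le_trans (lmono i _ _ jj') (lu i j').
  by apply: le_trans (lu i j) (umono i _ _ jj').
exists (\row_i sup (range (l i))) => j i; rewrite /in_cell mxE.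
have lsup : has_sup (range (l i)).
  split; first by exists (l i 0%N); exists 0%N.
  by exists (u i 0%N) => _ [j' _ <-].
apply/andP; split; first by apply: sup_upper_bound => //; exists j.
apply: ge_sup; first by exists (l i 0%N); exists 0%N.
by move=> _ [j' _ <-]; exact: lu'.
Qed.

Lemma branch_point_limit_set (R : realType) (eta : R) k0
    (b : nat -> {ffun 'I_n -> nat}) (x : 'rV[R]_n) :
  (forall i, b 0%N i < N k0)%N -> (forall j, b j.+1 \in ch (k0 + j)%N (b j)) ->
  (forall j, cell eta (N (k0 + j)%N) (b j) x) -> limit_set eta N ch x.
Proof.
move=> b0 bch xb; exists k0 => k kk0; exists (b (k - k0)%N), (b (k - k0).+1).
have bv j : (forall i, b j i < N (k0 + j))%N.
  elim: j => [|j IH]; first by rewrite addn0.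
  by rewrite addnS; exact: scheme_valid IH (bch j).
split; first by have := bv (k - k0)%N; rewrite subnKC.
  by have := bch (k - k0)%N; rewrite subnKC.
by have := xb (k - k0).+1; rewrite addnS subnKC.
Qed.

End SchemeTheory.

(** * Lower bound for the Hausdorff dimension *)

Lemma uniq_flatten_map (X Y : eqType) (f : X -> seq Y) (s : seq X) :
  uniq s -> {in s, forall x, uniq (f x)} ->
  {in s &, forall x y z, z \in f x -> z \in f y -> x = y} ->
  uniq (flatten [seq f x | x <- s]).
Proof.
elim: s => //= x s IH /andP[xs us] uf inj; rewrite cat_uniq uf ?mem_head //=.
apply/andP; split; last first.
  apply: IH us _ _ => [y ys|y y' ys y's]; first by rewrite uf // inE ys orbT.
  by apply: inj; rewrite inE ?ys ?y's orbT.
apply/hasPn => z /flatten_mapP[y ys zy]; apply/negP => zx.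
by move: xs; rewrite (inj x y _ _ z zx zy) ?ys ?mem_head // inE ys orbT.
Qed.

(** The recursion unfolds at the root; inductions on the last generation need this form. *)
Lemma descendants_snoc (X : Type) (ch : nat -> X -> seq X) j k a :
  descendants ch j.+1 k a =
  flatten [seq ch (k + j)%N c | c <- descendants ch j k a].
Proof.
elim: j k a => [|j IH] k a.
  by rewrite /= addn0 cats0; elim: (ch k a) => //= c s ->.
transitivity (flatten [seq descendants ch j.+1 k.+1 c | c <- ch k a]) => //.
rewrite [descendants ch j.+1 k a]/=.
elim: (ch k a) => //= c s IHs; rewrite map_cat flatten_cat -IHs.
by rewrite -addSnnS -IH.
Qed.

Lemma coord_le_diam (R : realType) (n : nat) (U : set 'rV[R]_n) (p q : 'rV[R]_n) :
  U p -> U q -> forall j, ((`|p 0 j - q 0 j|)%:E <= diam U)%E.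
Proof.
move=> Up Uq j; apply: (@le_trans _ _ (euclidean_dist p q)%:E); last first.
  by apply: ereal_sup_ubound; exists (p, q).
rewrite lee_fin -sqrtr_sqr ler_wsqrtr // (bigD1 j) //= lerDl.
by apply: sumr_ge0 => i _; exact: sqr_ge0.
Qed.

(** Covering sets may have diameter 0, while the mass estimate works at a positive scale; the
    replacement costs an arbitrarily small [e]. *)
Lemma powR_enlarge (R : realType) (s D sigma e : R) :
  0 <= s -> 0 <= D -> D <= sigma -> 0 < sigma -> 0 < e ->
  exists d, [/\ 0 < d, D <= d, d <= sigma & d `^ s <= D `^ s + e].
Proof.
move=> s0 D0 Ds sig0 e0; have [Dgt|] := ltP 0 D.
  by exists D; split => //; rewrite lerDl ltW.
move=> Dle; have -> : D = 0 by apply/eqP; rewrite eq_le Dle.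
have [->|sn0] := eqVneq s 0.
  by exists sigma; split => //; [exact: ltW|rewrite !powRr0 lerDl ltW].
have s_gt0 : 0 < s by rewrite lt0r sn0.
have d0 : 0 < Num.min sigma (e `^ s^-1) by rewrite lt_min sig0 powR_gt0.
exists (Num.min sigma (e `^ s^-1)); split => //; [exact: ltW|by rewrite ge_min lexx|].
rewrite powR0 // add0r; apply: (@le_trans _ _ ((e `^ s^-1) `^ s)).
  apply: ge0_ler_powR => //; rewrite ?nnegrE ?powR_ge0 ?(ltW d0) //.
  by rewrite ge_min lexx orbT.
by rewrite -powRrM mulVf // powRr1 // ltW.
Qed.

Section HausdorffBound.
Variables (R : realType) (eta : R) (n : nat) (N A B : nat -> nat)
  (ch : nat -> {ffun 'I_n -> nat} -> seq {ffun 'I_n -> nat}).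
Hypothesis S : scheme N A B ch.
Hypothesis eta0 : 0 < eta.
Hypothesis n0 : (0 < n)%N.

Lemma scheme_descendants j k (a : {ffun 'I_n -> nat}) :
  (forall i, a i < N k)%N -> uniq (descendants ch j k a) /\
  forall c : {ffun 'I_n -> nat}, c \in descendants ch j k a ->
    (forall i, c i < N (k + j))%N.
Proof.
move=> va; elim: j => [|j [IHu IHv]].
  by split => // c; rewrite inE => /eqP->; rewrite addn0.
rewrite descendants_snoc; split.
  apply: uniq_flatten_map => // [c /IHv vc|c c' _ _ z zc zc'].
    by have [] := scheme_size S vc.
  apply/ffunP => i.
  by rewrite -(scheme_parent S zc i) -(scheme_parent S zc' i).
move=> c /flatten_mapP[a' /IHv va' cch]; rewrite addnS.
exact: (scheme_valid S va' cch).
Qed.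

(** Each cube of mesh [eta / (N k * A k)] contains at most one selected cube, so it suffices to
    count those cubes near [U]; their indices differ by less than [P] and are told apart by residues
    modulo [P]. *)
Lemma hit_count k d (U : set 'rV[R]_n) (L : seq {ffun 'I_n -> nat}) :
  0 <= d -> (forall p q, U p -> U q -> forall j, `|p 0 j - q 0 j| <= d) ->
  uniq L ->
  (forall c, c \in L -> (exists a, c \in ch k a) /\
      cell eta (N k.+1) c `&` U !=set0) ->
  (size L <= (Num.truncn (d / (eta / (N k * A k)%:R))).+2 ^ n)%N.
Proof.
move=> d0 dU uL LP.
set h := eta / _; set P := (_.+2).
have NA0 : (0 < N k * A k)%N.
  by rewrite muln_gt0 (scheme_N_gt0 S) ltnW ?(scheme_A S).
have h0 : 0 < h by rewrite divr_gt0 // ltr0n.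
pose red (c : {ffun 'I_n -> nat}) : {ffun 'I_n -> 'I_P} :=
  [ffun j => inord ((c j %/ B k) %% P)].
have close c c' : c \in L -> c' \in L ->
    forall j, (c j %/ B k < c' j %/ B k + P)%N.
  move=> /LP[_ [p [pc Up]]] /LP[_ [q [qc Uq]]] j.
  have := pc j; have := qc j; rewrite (scheme_NS S).
  move=> /(in_cell_div eta0 NA0 (scheme_B S k)) + /(in_cell_div eta0 NA0 (scheme_B S k)).
  rewrite /in_cell -/h -!natr1 !mulrDl !mul1r => /andP[a1 a2] /andP[b1 b2].
  have := dU p q Up Uq j; rewrite ler_distl => /andP[_ pq].
  set t := (c j %/ B k)%N in b1 b2 *; set t' := (c' j %/ B k)%N in a1 a2 *.
  have : t%:R * h <= (t'%:R + 1 + d / h) * h.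
    by rewrite !mulrDl mul1r divfK ?gt_eqF //; lra.
  rewrite ler_pM2r // => tt.
  have Lt : d / h < (Num.truncn (d / h)).+1%:R by apply: truncnS_gt.
  have : t%:R < (t' + P)%:R :> R.
    apply: le_lt_trans tt _; rewrite natrD -addrA ltrD2l /P.
    by rewrite -[ltRHS]natr1 addrC ltrD2r.
  by rewrite ltr_nat.
have red_inj : {in L &, injective red}.
  move=> c c' cL c'L e.
  have [[[a ca] _] [[a' ca'] _]] := (LP c cL, LP c' c'L).
  apply: (scheme_sep S ca ca') => j.
  apply: (@eq_mod_close _ _ P); [|exact: close|exact: close].
  have /ffunP/(_ j)/(congr1 val) := e.
  by rewrite !ffunE /= !inordK // ltn_mod.
have : uniq (map red L) by rewrite map_inj_in_uniq.
move=> /card_uniqP; rewrite size_map => <-.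
by rewrite (leq_trans (max_card _)) // card_ffun !card_ord.
Qed.

Variables (s : R) (k0 : nat).
Hypotheses (s0 : 0 <= s) (sn : s <= n%:R).
Hypothesis Ns : forall k, (k0 <= k)%N -> (N k.+1)%:R `^ s <= ((A k ^ n)./2)%:R :> R.

Let M k : nat := (A k ^ n)./2.
(** The mass of a node of level [k] when mass 1 at level 0 is shared equally among the children. *)
Let nu k : R := (\prod_(i < k) (M i)%:R)^-1.

Lemma half_pow_gt0 k : (0 < M k)%N.
Proof.
have : (0 < A k ^ n)%N by rewrite expn_gt0 ltnW ?(scheme_A S).
by have := scheme_half_pow S k n0; rewrite /M; lia.
Qed.

Lemma node_mass_gt0 k : 0 < nu k.
Proof. by rewrite invr_gt0 prodr_gt0 // => i _; rewrite ltr0n half_pow_gt0. Qed.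

Lemma node_massS k : nu k = (M k)%:R * nu k.+1.
Proof.
rewrite /nu big_ord_recr /= invfM mulrCA divff ?mulr1 //.
by rewrite pnatr_eq0 -lt0n half_pow_gt0.
Qed.

(** The last division alone suffices: [nu k.+1 = nu k / M k] with [M k >= N k.+1 ^ s], and
    [nu k <= nu k0]. *)
Lemma node_mass_le k : (k0 <= k)%N ->
  nu k * (N k)%:R `^ s <= nu k0 * (N k0)%:R `^ s.
Proof.
have N1 k' : 1 <= (N k')%:R `^ s :> R.
  rewrite -[leLHS](powRr0 (N k')%:R); apply: ler_powR => //.
  by rewrite ler1n (scheme_N_gt0 S).
have nule k' : (k0 <= k')%N -> nu k' <= nu k0.
  move=> /subnKC<-; elim: (k' - k0)%N => [|j IH]; first by rewrite addn0.
  rewrite addnS; apply: le_trans IH; rewrite [leRHS]node_massS.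
  by rewrite ler_peMl ?(ltW (node_mass_gt0 _)) // ler1n half_pow_gt0.
rewrite leq_eqVlt => /predU1P[-> //|]; case: k => // k k0k.
apply: (@le_trans _ _ (nu k.+1 * (M k)%:R)).
  by rewrite ler_wpM2l ?(ltW (node_mass_gt0 _)) // Ns.
rewrite mulrC -node_massS; apply: le_trans (nule k k0k) _.
by rewrite ler_peMr // ltW ?node_mass_gt0.
Qed.

(** Frostman's estimate. Choose [k] with [eta / N k.+1 < d <= eta / N k] and count at level [k.+1],
    comparing [d] with the intermediate mesh [h = eta / (N k * A k)]. *)
Lemma hit_mass (a0 : {ffun 'I_n -> nat}) (d : R) (U : set 'rV[R]_n) :
  (forall j, a0 j < N k0)%N -> 0 < d -> d <= eta / (N k0)%:R ->
  (forall p q, U p -> U q -> forall j, `|p 0 j - q 0 j| <= d) ->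
  exists2 K, (k0 < K)%N &
    (count (fun c : {ffun 'I_n -> nat} => `[< cell eta (N K) c `&` U !=set0 >])
       (descendants ch (K - k0) k0 a0))%:R * nu K
      <= 3 ^+ n.+1 * (N k0)%:R `^ s / eta `^ s * nu k0 * d `^ s.
Proof.
move=> va0 d0 dk0 dU.
have [k [kk0 dk dk1]] : exists k, [/\ (k0 <= k)%N, d <= eta / (N k)%:R &
    eta / (N k.+1)%:R < d].
  have ex : exists j, eta / (N (k0 + j).+1)%:R < d.
    have [G0 _ HG] := mesh_small eta0 d0; exists G0; apply: HG.
    by rewrite (leq_trans _ (ltnW (scheme_N_gtn S _))) // leqW ?leq_addl.
  case: (ex_minnP ex) => j dj jmin; exists (k0 + j)%N; split => //.
    exact: leq_addr.
  case: j dj jmin => [|j] dj jmin; first by rewrite addn0.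
  rewrite leNgt; apply/negP => Hd; have := jmin j; rewrite -addnS => /(_ Hd).
  by rewrite ltnn.
exists k.+1; first by rewrite ltnS.
set L := seq.filter (fun c : {ffun 'I_n -> nat} =>
   `[< cell eta (N k.+1) c `&` U !=set0 >]) (descendants ch (k.+1 - k0) k0 a0).
rewrite -size_filter -/L.
set h := eta / (N k * A k)%:R.
have NA0 : (0 < N k * A k)%N.
  by rewrite muln_gt0 (scheme_N_gt0 S) ltnW ?(scheme_A S).
have h0 : 0 < h by rewrite divr_gt0 // ltr0n.
have Lsize : (size L)%:R <= (d / h + 2) ^+ n :> R.
  apply: (@le_trans _ _ ((Num.truncn (d / h)).+2 ^ n)%:R).
    rewrite ler_nat; apply: (hit_count (ltW d0) dU).
      by apply: filter_uniq; have [] := scheme_descendants (k.+1 - k0) va0.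
    move=> c; rewrite mem_filter => /andP[/asboolP cU]; split => //.
    move: b; rewrite subSn // descendants_snoc subnKC //.
    by move=> /flatten_mapP[a _ ca]; exists a.
  rewrite natrX lerXn2r ?nnegrE //; first by rewrite addr_ge0 // divr_ge0 // ltW.
  have /andP[t1 _] := truncn_itv (ltW (divr_gt0 d0 h0)).
  by rewrite -natr1 -natr1 -addrA lerD.
have pow_pos (x : R) : 0 < x -> 0 < x `^ s by exact: powR_gt0.
have Nk0 j : 0 < (N j)%:R :> R by rewrite ltr0n (scheme_N_gt0 S).
have C0 : 0 <= nu k0 * (N k0)%:R `^ s.
  by rewrite mulr_ge0 ?powR_ge0 // ltW ?node_mass_gt0.
(* Below [h] at most [3 ^ n] nodes are hit, and the bound on their mass at level [k.+1] is
   enough. *)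
have [dh|hd] := leP d h.
  have : (size L)%:R <= 3 ^+ n :> R.
    apply: le_trans Lsize _; rewrite lerXn2r ?nnegrE //.
      by rewrite addr_ge0 // divr_ge0 // ltW.
    have : d / h <= 1 by rewrite ler_pdivrMr // mul1r.
    by lra.
  move=> L3; have nuK := node_mass_le (leqW kk0).
  have dN : eta `^ s <= d `^ s * (N k.+1)%:R `^ s.
    rewrite -powRM ?ler0n ?(ltW d0) //; apply: ge0_ler_powR => //.
    - by rewrite nnegrE ltW.
    - by rewrite nnegrE mulr_ge0 // ltW.
    - by rewrite -ler_pdivrMr // ltW.
  have nuK' : nu k.+1 <= nu k0 * (N k0)%:R `^ s / eta `^ s * d `^ s.
    rewrite -(ler_pM2r (pow_pos _ (Nk0 k.+1))); apply: le_trans nuK _.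
    have reorder (c e t y : R) : c / e * t * y = c * (t * y / e) by ring.
    by rewrite reorder ler_peMr // ler_pdivlMr ?mul1r // pow_pos.
  apply: (@le_trans _ _ (3 ^+ n * (nu k0 * (N k0)%:R `^ s / eta `^ s * d `^ s))).
    by rewrite ler_pM // ltW ?node_mass_gt0.
  have -> : 3 ^+ n.+1 * (N k0)%:R `^ s / eta `^ s * nu k0 * d `^ s =
     3 ^+ n.+1 * (nu k0 * (N k0)%:R `^ s / eta `^ s * d `^ s) by ring.
  rewrite ler_wpM2r ?(mulr_ge0 (divr_ge0 C0 (powR_ge0 _ _)) (powR_ge0 _ _)) //.
  by rewrite exprS ler_peMl ?exprn_ge0 // ler1n.
(* Above [h] at most [(3 d / h) ^ n] nodes are hit. Since [A k ^ n * nu k.+1 <= 3 * nu k], their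
   mass is at most a constant times [x ^ n * nu k], and [x ^ n <= x ^ s] because [x <= 1] and
   [s <= n]. *)
have d3h : d / h + 2 <= 3 * (d / h).
  have : 1 <= d / h by rewrite ler_pdivlMr // mul1r ltW.
  by lra.
pose x := d * (N k)%:R / eta.
have x0 : 0 < x by rewrite divr_gt0 // mulr_gt0.
have x1 : x <= 1 by rewrite ler_pdivrMr // mul1r -ler_pdivlMr.
have A0 : 0 < (A k ^ n)%:R :> R by rewrite ltr0n expn_gt0 ltnW ?(scheme_A S).
have dhE : d / h = x * (A k)%:R.
  by rewrite /h /x natrM invf_div; ring.
have LA : (size L)%:R <= 3 ^+ n * x ^+ n * (A k ^ n)%:R.
  apply: le_trans Lsize _; rewrite natrX -!exprMn -mulrA -dhE.
  have dh0 : 0 <= d / h by apply/ltW/divr_gt0.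
  rewrite lerXn2r ?nnegrE //; first by rewrite addr_ge0.
  exact: mulr_ge0.
have Anu : (A k ^ n)%:R * nu k.+1 <= 3 * nu k.
  rewrite [nu k]node_massS mulrA ler_wpM2r ?(ltW (node_mass_gt0 _)) //.
  by rewrite -natrM ler_nat; exact: (scheme_half_pow S k n0).
have xs : x ^+ n <= x `^ s.
  by rewrite -powR_mulrn ?(ltW x0) //; apply: ger_powR; rewrite ?x0.
have xsE : x `^ s = d `^ s * (N k)%:R `^ s / eta `^ s.
  suff <- : x `^ s * eta `^ s = d `^ s * (N k)%:R `^ s.
    by rewrite mulfK // gt_eqF ?pow_pos.
  by rewrite -!powRM ?ler0n ?(ltW d0) ?(ltW x0) ?(ltW eta0) // /x divfK // gt_eqF.
apply: (@le_trans _ _ (3 ^+ n * x ^+ n * (A k ^ n)%:R * nu k.+1)).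
  by rewrite ler_wpM2r ?(ltW (node_mass_gt0 _)).
rewrite -mulrA; apply: (@le_trans _ _ (3 ^+ n * x `^ s * (3 * nu k))).
  apply: ler_pM => //; last by rewrite ler_wpM2l ?exprn_ge0.
    by rewrite mulr_ge0 ?exprn_ge0 // ltW.
  by rewrite mulr_ge0 // ltW ?node_mass_gt0.
rewrite xsE.
have -> : 3 ^+ n * (d `^ s * (N k)%:R `^ s / eta `^ s) * (3 * nu k) =
   (3 ^+ n.+1 * d `^ s / eta `^ s) * (nu k * (N k)%:R `^ s) by rewrite exprS; ring.
have -> : 3 ^+ n.+1 * (N k0)%:R `^ s / eta `^ s * nu k0 * d `^ s =
   (3 ^+ n.+1 * d `^ s / eta `^ s) * (nu k0 * (N k0)%:R `^ s) by ring.
rewrite ler_wpM2l ?node_mass_le // ?mulr_ge0 ?invr_ge0 ?powR_ge0 ?exprn_ge0 //.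
Qed.

(** A cover of small total [s]-power hits less than the whole mass below a cube of level [k0], so
    some branch escapes all covering sets and its limit is an uncovered point. Each covering set is
    tested at a level of its own, so no compactness is involved. *)
Lemma hausdorff_measure_limit_set :
  hausdorff_measure s (limit_set eta N ch : set 'rV[R]_n) <> 0%E.
Proof.
move=> HE.
pose a0 : {ffun 'I_n -> nat} := [ffun=> 0%N].
have va0 j : (a0 j < N k0)%N by rewrite ffunE (scheme_N_gt0 S).
pose C := 3 ^+ n.+1 * (N k0)%:R `^ s / eta `^ s.
have N0 : 0 < (N k0)%:R :> R by rewrite ltr0n (scheme_N_gt0 S).
have C0 : 0 < C by rewrite divr_gt0 ?mulr_gt0 ?exprn_gt0 ?powR_gt0.
pose sigma := eta / (N k0)%:R; have sig0 : 0 < sigma by rewrite divr_gt0.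
(* One [e] bounds the sum over the cover, another pays for the enlarged diameters; the hit mass is
   then at most [C * nu k0 * 2 e = nu k0 / 2]. *)
pose e := (4 * C)^-1; have e0 : 0 < e by rewrite invr_gt0 mulr_gt0.
have : (hausdorff_premeasure s sigma (limit_set eta N ch : set 'rV[R]_n) < e%:E)%E.
  apply: (@le_lt_trans _ _ 0%E); last by rewrite lte_fin.
  by rewrite -HE; apply: ereal_sup_ubound; exists sigma.
move=> /ereal_inf_lt[_ [U [Udiam Ucov] <-] Usum].
have pow0 i : (0 <= diam_pow s (U i))%E.
  by rewrite /diam_pow; case: ifP => // _; exact: poweR_ge0.
pose hit i K (c : {ffun 'I_n -> nat}) := `[< cell eta (N K) c `&` U i !=set0 >].
have bound i : exists K, (k0 < K)%N /\
    (((count (hit i K) (descendants ch (K - k0) k0 a0))%:R * nu K)%:E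
      <= (C * nu k0)%:E * (diam_pow s (U i) + (e / (2 ^ i.+1)%:R)%:E))%E.
  have Cnu0 : 0 <= C * nu k0 by rewrite mulr_ge0 // ltW ?node_mass_gt0.
  have ei0 : 0 < e / (2 ^ i.+1)%:R by rewrite divr_gt0 // ltr0n expn_gt0.
  have [Ui0|/eqP/set0P[p0 Up0]] := pselect (U i = set0).
    exists k0.+1; split => //; rewrite (@eq_count _ _ pred0) ?count_pred0.
      by rewrite mul0r mule_ge0 ?lee_fin ?adde_ge0 ?pow0 // lee_fin ltW.
    by move=> c; apply/negbTE/negP => /asboolP[x [_]]; rewrite Ui0.
  have diam0 : (0 <= diam (U i))%E.
    apply: ereal_sup_ubound; exists (p0, p0) => //.
    by rewrite /euclidean_dist big1 ?sqrtr0 // => j _; rewrite subrr expr0n.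
  have diamE : diam (U i) = (fine (diam (U i)))%:E.
    rewrite fineK // ge0_fin_numE //.
    by apply: le_lt_trans (Udiam i) _; rewrite ltry.
  have powE : diam_pow s (U i) = ((fine (diam (U i))) `^ s)%:E.
    rewrite /diam_pow asboolF; last by move=> U0; rewrite U0 in Up0.
    by rewrite [in LHS]diamE poweR_EFin.
  have D0 : 0 <= fine (diam (U i)) by rewrite fine_ge0.
  have Ds : fine (diam (U i)) <= sigma by rewrite -lee_fin -diamE.
  have [d [d0 Dd dsig dpow]] := powR_enlarge s0 D0 Ds sig0 ei0.
  have Ud p q : U i p -> U i q -> forall j, `|p 0 j - q 0 j| <= d.
    move=> Up Uq j; apply: le_trans Dd; rewrite -lee_fin -diamE.
    exact: coord_le_diam.
  have [K k0K HK] := hit_mass va0 d0 dsig Ud.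
  exists K; split => //; rewrite powE -EFinD -EFinM lee_fin.
  by apply: le_trans HK _; rewrite ler_wpM2l.
have [K HK] := choice bound.
have [||||||b [b0 bP bhit]] := @branch_avoiding_hits R _ ch
   (fun k (a : {ffun 'I_n -> nat}) => forall j, (a j < N k)%N) nu
   (fun i => hit i (K i)) K k0 a0.
- exact: node_mass_gt0.
- by move=> k a va; have [_ ->] := scheme_size S va; exact: node_massS.
- by move=> k a c va cch; exact: (scheme_valid S va cch).
- exact: va0.
- by move=> i; rewrite ltnW // (HK i).1.
- apply: (@le_lt_trans _ _ (\sum_(0 <= i <oo)
     ((C * nu k0)%:E * (diam_pow s (U i) + (e / (2 ^ i.+1)%:R)%:E)))%E).
    apply: lee_nneseries => [i _ _|i _]; last exact: (HK i).2.
    by rewrite lee_fin mulr_ge0 // ltW ?node_mass_gt0.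
  rewrite nneseriesZl; last first.
    by move=> i _; rewrite adde_ge0 ?pow0 // lee_fin divr_ge0 // ltW.
  have Cnu0 : 0 < C * nu k0 by rewrite mulr_gt0 ?node_mass_gt0.
  apply: (@le_lt_trans _ _ ((C * nu k0)%:E * (e%:E + e%:E))%E).
    rewrite lee_pmul2l //; apply: le_trans (epsilon_trick xpredT pow0 (ltW e0)) _.
    by rewrite leeD2r // ltW.
  rewrite -EFinD -EFinM lte_fin.
  have -> : C * nu k0 * (e + e) = nu k0 / 2.
    by rewrite /e; field; rewrite gt_eqF.
  by rewrite ltr_pdivrMr // ltr_pMr ?node_mass_gt0 // ltr1n.
have [x xb] := scheme_branch_point S eta0 (fun j => (bP j).2).
have Ex : limit_set eta N ch x.
  apply: (branch_point_limit_set S _ (fun j => (bP j).2) xb).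
  by rewrite b0.
have [i _ Uix] := Ucov x Ex.
have /negP := bhit i; apply; apply/asboolP; exists x; split => //.
by have := xb (K i - k0)%N; rewrite subnKC // ltnW // (HK i).1.
Qed.

End HausdorffBound.

(** * Density and Minkowski dimension *)

Lemma cell_exists_cube (R : realType) (eta : R) (n G : nat) (y : 'rV[R]_n) :
  0 < eta -> (0 < G)%N -> cube eta y ->
  exists a : {ffun 'I_n -> nat}, (forall j, a j < G)%N /\ cell eta G a y.
Proof.
move=> eta0 G0 ycube.
have h0 : 0 < eta / G%:R by rewrite divr_gt0 ?ltr0n.
have y0 j : 0 <= y 0 j by have /andP[] := ycube j.
have yc := cell_exists eta0 G0 y0.
(* The minimum sends a coordinate equal to [eta] to the last cell. *)
pose a : {ffun 'I_n -> nat} :=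
  [ffun j => minn (Num.truncn (y 0 j / (eta / G%:R))) G.-1].
exists a; split => j; first by rewrite ffunE gtn_min prednK // leqnn orbT.
have := yc j; rewrite /in_cell !ffunE.
set t := Num.truncn _; case: (leqP t G.-1) => // Gt /andP[ty _].
have /andP[_ yeta] := ycube j.
have Ge : eta = G%:R * (eta / G%:R) by rewrite mulrC divfK // pnatr_eq0 -lt0n.
rewrite prednK //; apply/andP; split; last by rewrite -Ge.
by apply: le_trans ty; rewrite ler_wpM2r ?(ltW h0) // ler_nat ltnW.
Qed.

Lemma limit_set_sub_cube (R : realType) (eta : R) n N A B ch :
  0 < eta -> @scheme n N A B ch -> limit_set eta N ch `<=` @cube R eta n.
Proof.
move=> eta0 S x [k0 /(_ k0 (leqnn _))[a [c [va cch xc]]]] j.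
have xa := scheme_cell_sub S eta0 cch xc.
have := xa j; rewrite /in_cell => /andP[x1 x2].
have N0 : 0 < (N k0)%:R :> R by rewrite ltr0n (scheme_N_gt0 S).
have h0 : 0 <= eta / (N k0)%:R by rewrite divr_ge0 // ltW.
apply/andP; split; first by apply: le_trans x1; rewrite mulr_ge0.
apply: le_trans x2 _; rewrite mulrCA -[leRHS]mulr1 ler_wpM2l ?(ltW eta0) //.
by rewrite ler_pdivrMr // mul1r ler_nat va.
Qed.

Lemma limit_set_dense (R : realType) (eta : R) n N A B ch :
  0 < eta -> (0 < n)%N -> @scheme n N A B ch ->
  forall y : 'rV[R]_n, cube eta y -> forall rho, 0 < rho ->
  exists2 x, limit_set eta N ch x & forall j, `|x 0 j - y 0 j| < rho.
Proof.
move=> eta0 n0 S y ycube rho rho0.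
have [G _ HG] := mesh_small eta0 rho0.
(* [G] now serves as a level, which is fine enough because [G < N G]; a branch is started in the
   cell of [y]. *)
have [a [va ya]] := cell_exists_cube eta0 (scheme_N_gt0 S G) ycube.
pose valid k (a : {ffun 'I_n -> nat}) := forall j, (a j < N k)%N.
have [k c vc|b [b0 bP]] := @exists_branch _ ch valid G a va.
  have [c' c'ch] := scheme_ch_neq0 S n0 vc; exists c' => //.
  exact: (scheme_valid S vc c'ch).
have [x xb] := scheme_branch_point S eta0 (fun j => (bP j).2).
exists x.
  by apply: (branch_point_limit_set S _ (fun j => (bP j).2) xb); rewrite b0.
move=> j; apply: le_lt_trans (HG (N G) (ltnW (scheme_N_gtn S G))).
have := xb 0%N; rewrite addn0 b0 => xa.
exact: in_cell_dist (xa j) (ya j).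
Qed.

(** Grid points spaced by [3 * delta] are approximated within [delta / 2] by points of [E]. Any two
    of these are more than [delta] apart, so each covering set contains at most one. *)
Lemma covering_number_ge (R : realType) (eta : R) (n : nat) (E : set 'rV[R]_n)
    (delta : R) :
  0 < eta -> 0 < delta -> delta <= eta / 6 ->
  (forall y, cube eta y -> forall rho, 0 < rho ->
    exists2 x, E x & forall j, `|x 0 j - y 0 j| < rho) ->
  (((eta / 6 / delta) ^+ n)%:E <= covering_number E delta)%E.
Proof.
move=> eta0 d0 de Edense; apply: le_ereal_inf_tmp => _ [k [U [Udiam Ucov]] <-].
rewrite lee_fin.
pose G := Num.truncn (eta / (3 * delta)).
have d30 : 0 < 3 * delta by rewrite mulr_gt0.
have Gle : G%:R * (3 * delta) <= eta.
  rewrite -ler_pdivlMr //.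
  by have /andP[] := truncn_itv (ltW (divr_gt0 eta0 d30)).
have Gge : eta / 6 / delta <= G%:R.
  have : eta / (3 * delta) < G%:R + 1 by rewrite natr1; exact: truncnS_gt.
  have -> : eta / (3 * delta) = 2 * (eta / 6 / delta).
    by field; rewrite gt_eqF.
  have : 1 <= eta / 6 / delta by rewrite ler_pdivlMr // mul1r.
  by lra.
apply: (@le_trans _ _ (G ^ n)%:R).
  rewrite natrX lerXn2r ?nnegrE //.
  by rewrite ltW // divr_gt0 // divr_gt0.
pose g (c : {ffun 'I_n -> 'I_G}) : 'rV[R]_n := \row_j ((c j)%:R * (3 * delta)).
have gcube c : cube eta (g c).
  move=> j; rewrite mxE mulr_ge0 ?(ltW d30) //=.
  apply: le_trans Gle; rewrite ler_wpM2r ?(ltW d30) // ler_nat.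
  exact: ltnW.
have dhalf : 0 < delta / 2 by rewrite divr_gt0.
have /choice[e eP] c : exists x, E x /\ forall j, `|x 0 j - g c 0 j| < delta / 2.
  by have [x] := Edense _ (gcube c) _ dhalf; exists x.
have /choice[i iP] c : exists i, U i (e c).
  by have [i] := Ucov _ (eP c).1; exists i.
have iinj : injective i.
  move=> c c' cc'; apply/ffunP => j; apply/val_inj/eqP => /=.
  rewrite eqn_leq; wlog suff: c c' cc' / (c j <= c' j)%N.
    by move=> H; rewrite !H.
  have Ue := iP c; rewrite cc' in Ue.
  have := le_trans (coord_le_diam Ue (iP c') j) (Udiam (i c')).
  rewrite lee_fin ler_distl => /andP[_ e1].
  have := (eP c).2 j; rewrite ltr_distl mxE => /andP[e2 _].
  have := (eP c').2 j; rewrite ltr_distl mxE => /andP[_ e3].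
  rewrite leqNgt; apply/negP => lt.
  have : ((c' j).+1%:R : R) * (3 * delta) <= (c j)%:R * (3 * delta).
    by rewrite ler_wpM2r ?(ltW d30) // ler_nat.
  rewrite -natr1 mulrDl mul1r; lra.
rewrite ler_nat; have := leq_card i iinj.
by rewrite card_ffun !card_ord.
Qed.

(** Cover by grid cells of mesh at most [delta / n]; their Euclidean diameter is at most [n] times
    the mesh. *)
Lemma covering_number_le (R : realType) (eta : R) (n : nat) (E : set 'rV[R]_n)
    (delta : R) :
  0 < eta -> (0 < n)%N -> 0 < delta -> delta <= n%:R * eta ->
  E `<=` @cube R eta n ->
  (covering_number E delta <= ((2 * n%:R * eta / delta) ^+ n)%:E)%E.
Proof.
move=> eta0 n0 d0 dn Ecube.
have nR : 0 < n%:R :> R by rewrite ltr0n.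
have y0 : 0 <= n%:R * eta / delta by rewrite divr_ge0 // ?mulr_ge0 // ltW.
pose G := (Num.truncn (n%:R * eta / delta)).+1.
have Gle : G%:R <= 2 * n%:R * eta / delta.
  have /andP[t1 _] := truncn_itv y0.
  have : 1 <= n%:R * eta / delta by rewrite ler_pdivlMr // mul1r.
  have -> : 2 * n%:R * eta / delta = 2 * (n%:R * eta / delta) by ring.
  by move=> y1; rewrite /G -natr1; lra.
have nh : n%:R * (eta / G%:R) <= delta.
  rewrite mulrA ler_pdivrMr ?ltr0n // [delta * _]mulrC -ler_pdivrMr //.
  by rewrite ltW // truncnS_gt.
have h0 : 0 <= eta / G%:R by rewrite divr_ge0 // ltW.
apply: (@le_trans _ _ ((G ^ n)%:R)%:E); last first.
  by rewrite lee_fin natrX lerXn2r ?nnegrE // (le_trans _ Gle).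
apply: ereal_inf_lbound; exists (G ^ n)%N => //.
have cardG : #|{ffun 'I_n -> 'I_G}| = (G ^ n)%N by rewrite card_ffun !card_ord.
rewrite -cardG.
exists (fun i => cell eta G (fun j => (enum_val i : {ffun 'I_n -> 'I_G}) j)); split.
  move=> i; apply: ge_ereal_sup => _ [[p q] [/= pc qc] <-]; rewrite lee_fin.
  apply: le_trans nh; rewrite /euclidean_dist -[leRHS]ger0_norm ?(mulr_ge0 (ltW nR) h0) //.
  rewrite -sqrtr_sqr ler_wsqrtr //.
  apply: (@le_trans _ _ (\sum_(j < n) (eta / G%:R) ^+ 2)).
    apply: ler_sum => j _; rewrite -real_normK ?num_real //.
    by rewrite lerXn2r ?nnegrE //; exact: in_cell_dist (pc j) (qc j).
  rewrite sumr_const card_ord -[leLHS]mulr_natl [leRHS]exprMn ler_wpM2r ?sqr_ge0 //.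
  by rewrite expr2 ler_peMl // ler1n.
move=> x Ex; have xc := Ecube x Ex.
have [a [aG xa]] := cell_exists_cube eta0 (isT : 0 < G)%N xc.
pose c : {ffun 'I_n -> 'I_G} := [ffun j => Ordinal (aG j)].
exists (enum_rank c) => // j; rewrite enum_rankK ffunE /=; exact: xa.
Qed.

Lemma ln_inv_cvg0 (R : realType) : (ln (x : R)^-1)^-1 @[x --> 0^'+] --> (0 : R).
Proof.
apply/cvgr0Pnorm_lt => e e0.
have := @lnNy R; move=> /cvgrNyPlt/(_ (- e^-1)) H.
near=> x.
have x0 : 0 < x by near: x; exact: nbhs_right_gt.
have lx : ln x < - e^-1 by near: x; exact: H.
have L0 : e^-1 < ln x^-1 by rewrite lnV // ltrNr.
have Lp : 0 < ln x^-1 by apply: lt_trans L0; rewrite invr_gt0.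
by rewrite gtr0_norm ?invr_gt0 // invf_plt.
Unshelve. all: by end_near.
Qed.

(** Both bounds on the covering number have the form [(c / x) ^ n], for which the logarithmic
    quotient is [n (1 + ln c / ln (1 / x))]; squeeze. *)
Lemma dense_minkowski_dim (R : realType) (eta : R) (n : nat) (E : set 'rV[R]_n) :
  0 < eta -> (0 < n)%N -> E `<=` @cube R eta n ->
  (forall y, cube eta y -> forall rho, 0 < rho ->
    exists2 x, E x & forall j, `|x 0 j - y 0 j| < rho) ->
  has_minkowski_dim E n%:R.
Proof.
move=> eta0 n0 Ecube Edense; rewrite /has_minkowski_dim.
have nR : 0 < n%:R :> R by rewrite ltr0n.
pose g c (x : R) : R := n%:R * (1 + ln c * (ln x^-1)^-1).
have gcvg c : (g c x)%:E @[x --> 0^'+] --> (n%:R : R)%:E.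
  apply: cvg_EFin; first by apply: nearW.
  rewrite /comp /= /g -[X in _ --> X](_ : n%:R * (1 + ln c * 0) = n%:R); last first.
    by rewrite mulr0 addr0 mulr1.
  apply: cvgMr; apply: cvgD; first exact: cvg_cst.
  by apply: cvgMr; exact: ln_inv_cvg0.
have gE c x : 0 < c -> 0 < x -> 0 < ln x^-1 ->
    (lne ((c / x) ^+ n)%:E * ((ln x^-1)^-1)%:E = (g c x)%:E)%E.
  move=> c0 x0 L0; rewrite lne_EFin ?exprn_gt0 ?divr_gt0 // -EFinM; congr EFin.
  rewrite lnXn ?divr_gt0 // lnM ?posrE ?invr_gt0 // /g -[(_ + _) *+ n]mulr_natl.
  by rewrite -mulrA mulrDl divff ?gt_eqF // [1 + _]addrC.
have c1 : 0 < eta / 6 by rewrite divr_gt0.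
have c2 : 0 < 2 * n%:R * eta by rewrite !mulr_gt0.
apply: (@squeeze_cvge _ _ _ _ (fun x => (g (eta / 6) x)%:E) _
  (fun x => (g (2 * n%:R * eta) x)%:E)) => //.
near=> x.
have x0 : 0 < x by near: x; exact: nbhs_right_gt.
have x1 : x < 1 by near: x; exact: nbhs_right_lt.
have x6 : x < eta / 6 by near: x; exact: nbhs_right_lt.
have xn : x < n%:R * eta by near: x; apply: nbhs_right_lt; rewrite mulr_gt0.
have L0 : 0 < ln x^-1 by rewrite ln_gt0 // invf_gt1.
have iL0 : (0 <= ((ln x^-1)^-1)%:E)%E by rewrite lee_fin invr_ge0 ltW.
have lo := covering_number_ge eta0 x0 (ltW x6) Edense.
have hi := covering_number_le eta0 n0 x0 (ltW xn) Ecube.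
have pos c : 0 < c -> (0 <= ((c / x) ^+ n)%:E)%E.
  by move=> c0; rewrite lee_fin exprn_ge0 // divr_ge0 // ltW.
have cov0 : (0 <= covering_number E x)%E by apply: le_trans (pos _ c1) lo.
rewrite -!gE //; apply/andP; split; apply: lee_wpmul2r => //;
  by rewrite lee_lne ?in_itv /= ?leey ?andbT ?pos ?cov0.
Unshelve. all: by end_near.
Qed.

(** * Avoidance of the zeros and conclusion *)

(** Two distinct points differ in some coordinate and are separated once the mesh is below that gap;
    there are finitely many pairs. *)
Lemma distinct_cells (R : realType) (eta : R) (n v : nat) (N : nat -> nat)
    (x : 'I_v -> 'rV[R]_n) :
  0 < eta -> (forall k, k < N k)%N -> injective x ->
  exists k0, forall k, (k0 <= k)%N -> forall c : 'I_v -> {ffun 'I_n -> nat},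
    (forall i, cell eta (N k) (c i) (x i)) -> injective c.
Proof.
move=> eta0 Nk xinj.
have pair (p : 'I_v * 'I_v) : exists k0, p.1 != p.2 -> forall k, (k0 <= k)%N ->
    forall c : {ffun 'I_n -> nat},
    cell eta (N k) c (x p.1) -> ~ cell eta (N k) c (x p.2).
  have [->|pne] := eqVneq p.1 p.2; first by exists 0%N.
  have [j xj] : exists j, x p.1 0 j != x p.2 0 j.
    apply: contrapT => H; move/eqP: pne; apply; apply: xinj; apply/rowP => j.
    by apply: contrapT => /eqP xj; apply: H; exists j.
  have xj0 : 0 < `|x p.1 0 j - x p.2 0 j| by rewrite normr_gt0 subr_eq0.
  have [G _ HG] := mesh_small eta0 xj0.
  exists G => _ k Gk c c1 c2.
  have := le_lt_trans (in_cell_dist (c1 j) (c2 j))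
    (HG _ (leq_trans Gk (ltnW (Nk k)))).
  by rewrite ltxx.
have {pair} [k0 Hk0] := choice pair.
exists (\max_p k0 p) => k kk c cx i i' cii'; apply/eqP/contraT => ii'.
have := Hk0 (i, i') ii' k (leq_trans (leq_bigmax (i, i')) kk) (c i) (cx i).
by rewrite cii' => /(_ (cx i')).
Qed.

(** Finds one stage that is late enough for all purposes: it treats the piece [j0], all points lie
    in selected cubes, and these cubes are distinct. *)
Lemma limit_set_avoids (R : realType) (eta : R) (n v : nat) N A B ch
    (x : 'I_v -> 'rV[R]_n) (j0 : nat) :
  0 < eta -> @scheme n N A B ch -> injective x ->
  (forall i, limit_set eta N ch (x i)) ->
  exists k (c : 'I_v -> {ffun 'I_n -> nat}), [/\ (j0 < k)%N, injective c,
    forall i, exists a, c i \in ch k a & forall i, cell eta (N k.+1) (c i) (x i)].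
Proof.
move=> eta0 S xinj xE.
have [k0 Hk0] := distinct_cells eta0 (scheme_N_gtn S) xinj.
have [k1 Hk1] := choice xE.
pose k := maxn j0.+1 (maxn k0 (\max_i k1 i)).
have cell_k i : exists c : {ffun 'I_n -> nat}, (exists a, c \in ch k a) /\
    cell eta (N k.+1) c (x i).
  have [|a [c [_ cch xc]]] := Hk1 i k.
    by rewrite !leq_max leq_bigmax !orbT.
  by exists c; split => //; exists a.
have [c Hc] := choice cell_k.
exists k, c; split.
- by rewrite leq_max leqnn.
- apply: (Hk0 k.+1) => [|i]; last exact: (Hc i).2.
  by rewrite leqW // !leq_max leqnn orbT.
- by move=> i; exact: (Hc i).1.
- by move=> i; exact: (Hc i).2.
Qed.

Lemma cube_tuple_point (R : realType) (eta : R) (n v : nat)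
    (x : 'I_v -> 'rV[R]_n) :
  (forall i, cube eta (x i)) -> cube eta (tuple_point x).
Proof.
by move=> xc k; case/mxvec_indexP: k => i j; rewrite mxvecE mxE; exact: xc.
Qed.

(* The library's 'J f y acts on row vectors: it is the transpose of the
   m x nv Jacobian matrix. *)
Theorem theorem1p2 (R : realType) (eta : R) (m n v : nat)
    (eta_gt0 : 0 < eta) (m_gt0 : (0 < m)%N) (n_gt0 : (0 < n)%N)
    (v_ge3 : (3 <= v)%N) (m_le : (m <= n * (v - 1))%N)
    (Q : countType) (f : Q -> 'rV[R]_(v * n) -> 'rV[R]_m)
    (f_C2 : forall q, class_C 2 (f q))
    (f_rank : forall q y, cube eta y -> f q y = 0 ->
       \rank ('J (f q) y)^T = m) :
  exists E : set 'rV[R]_n,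
    [/\ E `<=` @cube R eta n,
        ((m%:R / (v%:R - 1))%:E <= hausdorff_dim E)%E,
        has_minkowski_dim E n%:R
      & forall (q : Q) (x : 'I_v -> 'rV[R]_n),
          injective x -> (forall i, E (x i)) -> f q (tuple_point x) <> 0].
Proof.
have v1 : (1 < v)%N by apply: ltnW.
have vR : 0 < v%:R - 1 :> R by rewrite subr_gt0 ltr1n.
have [Z Zthin Zcover] := countable_thin_cover eta_gt0 f_C2 f_rank.
have [N [A [B [ch [S Npow Zavoid]]]]] :=
  exists_scheme m_gt0 n_gt0 v1 m_le Zthin.
exists (limit_set eta N ch); split.
- exact: limit_set_sub_cube eta_gt0 S.
- apply: le_ereal_inf_tmp => _ [s [s0 Hs] <-]; rewrite lee_fin leNgt.
  apply/negP => sm.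
  have sn : s <= n%:R.
    apply: (le_trans (ltW sm)); rewrite ler_pdivrMr //.
    have -> : v%:R - 1 = (v - 1)%:R :> R by rewrite natrB // ltnW.
    by rewrite -natrM ler_nat.
  have gap : 0 < m%:R / (v%:R - 1) - s by rewrite subr_gt0.
  (* From [k0] on, [1 / (k + 1)] is below the gap, so the stage exponent is at least [s]. *)
  have [k0 _ Hk0] := mesh_small ltr01 gap.
  apply: (@hausdorff_measure_limit_set _ _ _ _ _ _ _ S eta_gt0 n_gt0 s k0) => // k kk.
  apply: le_trans (Npow k); apply: ler_powR.
    by rewrite ler1n (scheme_N_gt0 S).
  have := Hk0 k.+1 (leqW kk); rewrite div1r => kgap.
  by rewrite lerBrDr addrC -lerBrDr ltW.
- apply: (dense_minkowski_dim eta_gt0 n_gt0).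
    exact: limit_set_sub_cube eta_gt0 S.
  exact: limit_set_dense eta_gt0 n_gt0 S.
(* A zero would lie in some [Z j], and also in a product of distinct cubes selected at a stage after
   [j], which misses [Z j]. *)
- move=> q x xinj xE fx.
  have xcube i : cube eta (x i) := limit_set_sub_cube eta_gt0 S (xE i).
  have [j Zj] := Zcover q _ (cube_tuple_point xcube) fx.
  have [k [c [jk cinj cch xc]]] := limit_set_avoids j eta_gt0 S xinj xE.
  apply: (Zavoid k c cinj cch j jk); exists (tuple_point x) => // i l.
  by rewrite mxvecE mxE; exact: xc.
Qed.
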